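(* Let $\mathcal{P}$ be a unitary set-operad and $n\in\mathbb{N}$. There is a natural equivalence of categories between the category of reduced polynomial functors of degree $\le n$ from $Free(\mathcal{P})$ to $Ab$ and the category of pseudo-Mackey functors from $\Omega(\mathcal{P})$ to $Ab$ which have zero values on $\underline{0}$ and on sets of cardinality $>n$.
   Context: Operads. A set-operad $\mathcal{P}$ consists of sets $\mathcal{P}(j)$, $j\ge 0$, with right actions of the symmetric groups $\mathfrak{S}_j$, a unit $1_{\mathcal{P}}\in\mathcal{P}(1)$ and composition maps $\gamma:\mathcal{P}(n)\times\mathcal{P}(m_1)\times\cdots\times\mathcal{P}(m_n)\to\mathcal{P}(m_1+\cdots+m_n)$ that are associative, unital and equivariant in the usual sense. It is unitary if $\mathcal{P}(0)=\{0_{\mathcal{P}}\}$. A $\mathcal{P}$-algebra is a set $X$ with maps $\mu_j:\mathcal{P}(j)\times_{\mathfrak{S}_j}X^j\to X$, associative and unital. $\mathcal{F}_{\mathcal{P}}(X)=\coprod_{n\ge0}\mathcal{P}(n)\times_{\mathfrak{S}_n}X^n$ is the free $\mathcal{P}$-algebra on $X$; $Free(\mathcal{P})$ is the full subcategory of $\mathcal{P}$-algebras on the objects $\mathcal{F}_{\mathcal{P}}(\underline{n})$, $n\ge0$, where $\underline{n}=\{1,\dots,n\}$. Polynomial functors. $Free(\mathcal{P})$ is a pointed category with finite coproducts $\vee$. A functor $F:Free(\mathcal{P})\to Ab$ is reduced if $F(0)=0$. For $m\ge1$, $cr_mF(X_1,\dots,X_m)=\ker\big(F(X_1\vee\cdots\vee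 X_m)\to\bigoplus_{k=1}^mF(X_1\vee\cdots\vee\widehat{X_k}\vee\cdots\vee X_m)\big)$, the components being induced by the retractions killing the $k$-th summand. $F$ is polynomial of degree $\le n$ if $cr_{n+1}F=0$. The categories $\mathcal{S}(\mathcal{P})$ and $\Omega(\mathcal{P})$. The objects of $\mathcal{S}(\mathcal{P})$ are the sets $\underline{n}$, $n\ge 0$; a morphism $\underline{n}\to\underline{m}$ is a pair $(f,\omega^f)$ with $f:\underline{n}\to\underline{m}$ a map and $\omega^f\in\prod_{y\in\underline{m}}\mathcal{P}(|f^{-1}(y)|)$. The composite of $(f,\omega^f):\underline n\to\underline m$ and $(g,\omega^g):\underline m\to\underline l$ is $(g\circ f,\omega^{g\circ f})$ with $\omega^{g\circ f}_i=\gamma(\omega^g_i;\omega^f_{j_1},\dots,\omega^f_{j_s}).\sigma_i$, where $g^{-1}(i)=\{j_1<\dots<j_s\}$ and, if $(x_1,x_2,\dots)$ is the natural ordering of $(g\circ f)^{-1}(i)$ and $(y_1,y_2,\dots)$ is its ordering listing first $f^{-1}(j_1)$ in natural order, then $f^{-1}(j_2)$, etc., then $\sigma_i(k)=l$ where $y_l=x_k$. $\Omega(\mathcal{P})$ is the subcategory with all objects and the morphisms $(f,\omega^f)$ with $f$ surjective. $\Omega$ is the category of the sets $\underline{n}$ and surjective maps. The double category $\Omega(\mathcal{P})_2$. Horizontal arrows: morphisms of $\Omega$; vertical arrows: morphisms of $\Omega(\mathcal{P})$. A square $\mathcal{D}$ consists of horizontal $f:A\to B$, $g:C\to D$ and vertical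 $(\phi,\omega^\phi):A\to C$, $(\psi,\omega^\psi):B\to D$ such that $\psi f=g\phi$ is a pullback diagram of sets and, for all $c\in C$, $g_*(\omega^\phi_c)=\omega^\psi_{g(c)}$. Here $g_*:\mathcal{P}(|\phi^{-1}(c)|)\to\mathcal{P}(|\psi^{-1}(g(c))|)$ is induced by the bijection $\phi^{-1}(c)\to\psi^{-1}(g(c))$ given by $f$: identifying both fibres with some $\underline{r}$ by their natural orders, this is a permutation $h$ of $\underline{r}$, and $g_*(\omega)=\omega.h^{-1}$. Given $g$ and $(\psi,\omega^\psi)$ with common target there is such a square, unique up to isomorphism. Double isomorphisms are the pairs $(f,u)$ with $f:A\to A$ a bijection and $u=(f,(1_{\mathcal{P}},\dots,1_{\mathcal{P}}))$. For $A'\subset A$ with inclusion $i$ ($A'$ identified with $\underline{|A'|}$ by the order-preserving bijection), let $f_{A'}=f\circ i$ and $(\phi,\omega^\phi)_{A'}=(\phi,\omega^\phi)\circ(i,\omega^i)$, where $\omega^i_y=1_{\mathcal{P}}$ for $y\in A'$ and $\omega^i_y=0_{\mathcal{P}}$ otherwise. $A'$ is $\mathcal{D}$-admissible if $f\circ i$ and $\phi\circ i$ are surjective; $Adm(\mathcal{D})$ is the set of these. Pseudo-Mackey functors. A Janus functor $M:\Omega(\mathcal{P})_2\to Ab$ is a pair of functors $M_*:\Omega\to Ab$ and $M^*:\Omega(\mathcal{P})^{op}\to Ab$ agreeing on objects. It is a pseudo-Mackey functor (from $\Omega(\mathcal{P})$ to $Ab$) if (1) $M_*(f)M^*(u)=\mathrm{Id}$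 for every double isomorphism $(f,u)$; (2) for every square $\mathcal{D}$ in $\Omega(\mathcal{P})_2$ with horizontal arrows $f:A\to B$, $g:C\to D$ and vertical arrows $(\phi,\omega^\phi):A\to C$, $(\psi,\omega^\psi):B\to D$, $M^*(\psi,\omega^\psi)\circ M_*(g)=\sum_{A'\in Adm(\mathcal{D})}M_*(f_{A'})\circ M^*((\phi,\omega^\phi)_{A'})$. Morphisms are families of homomorphisms natural with respect to both $M_*$ and $M^*$. *)

(* Defs.v *)
From HB Require Import structures.
From mathcomp Require Import all_boot all_order all_algebra all_fingroup.
From mathcomp Require Import generic_quotient boolp.

Set Implicit Arguments.
Unset Strict Implicit.
Unset Printing Implicit Defensive.

Import GRing.Theory.

Record category := Category {
  ob :> Type;
  hom : ob -> ob -> Type;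
  idc : forall A, hom A A;
  comp : forall A B C, hom B C -> hom A B -> hom A C;
  comp1c : forall A B (f : hom A B), comp (idc B) f = f;
  compc1 : forall A B (f : hom A B), comp f (idc A) = f;
  compA : forall A B C D (h : hom C D) (g : hom B C) (f : hom A B),
      comp h (comp g f) = comp (comp h g) f }.
Arguments hom {c} A B.
Arguments idc {c} A.
Arguments comp {c A B C} g f : rename.

Definition opposite (C : category) : category :=
  @Category C (fun A B => @hom C B A) (fun A => idc A)
    (fun A B D g f => comp f g)
    (fun A B f => compc1 f) (fun A B f => comp1c f)
    (fun A B D E h g f => esym (compA f g h)).

Definition full_sub (C : category) (I : Type) (J : I -> C) : category :=
  @Category I (fun i j => hom (J i) (J j)) (fun i => idc (J i))
    (fun i j k g f => comp g f)
    (fun i j f => comp1c f) (fun i j f => compc1 f)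
    (fun i j k l h g f => compA h g f).

(* The action on arrows of a functor with a prescribed action on objects. *)
Record functor_on (C D : category) (F0 : C -> D) := FunctorOn {
  farr : forall A B : C, hom A B -> hom (F0 A) (F0 B);
  farr_id : forall A : C, farr (idc A) = idc (F0 A);
  farr_comp : forall (A B E : C) (g : hom B E) (f : hom A B),
      farr (comp g f) = comp (farr g) (farr f) }.

Record functor (C D : category) := Functor {
  fob :> C -> D;
  fon : functor_on fob }.

Definition fmap (C D : category) (F : functor C D) (A B : C) (f : hom A B) :
  hom (F A) (F B) := farr (fon F) f.

Definition id_functor (C : category) : functor C C :=
  @Functor C C id (@FunctorOn C C id (fun _ _ f => f)
    (fun _ => erefl) (fun _ _ _ _ _ => erefl)).

Section FunctorComp.
Variables (C D E : category) (G : functor D E) (F : functor C D).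

Lemma fcomp_id (A : C) : fmap G (fmap F (idc A)) = idc (G (F A)).
Proof. by rewrite /fmap !farr_id. Qed.

Lemma fcomp_comp (A B A' : C) (g : hom B A') (f : hom A B) :
  fmap G (fmap F (comp g f)) = comp (fmap G (fmap F g)) (fmap G (fmap F f)).
Proof. by rewrite /fmap !farr_comp. Qed.

Definition functor_comp : functor C E :=
  @Functor C E (fun A => G (F A)) (FunctorOn fcomp_id fcomp_comp).
End FunctorComp.

Section NatTrans.
Variables C D : category.

Record nat_trans (F G : functor C D) := NatTrans {
  nt :> forall A : C, hom (F A) (G A);
  nt_natural : forall (A B : C) (f : hom A B),
      comp (nt B) (fmap F f) = comp (fmap G f) (nt A) }.

Lemma nat_trans_ext (F G : functor C D) (s t : nat_trans F G) :
  (forall A, s A = t A) -> s = t.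
Proof.
case: s t => [s hs] [t ht] /= e.
have {}e : s = t by apply: functional_extensionality_dep.
by case: _ / e in ht *; congr NatTrans; apply: Prop_irrelevance.
Qed.

Lemma nt_id_natural (F : functor C D) (A B : C) (f : hom A B) :
  comp (idc (F B)) (fmap F f) = comp (fmap F f) (idc (F A)).
Proof. by rewrite comp1c compc1. Qed.

Definition nt_id (F : functor C D) : nat_trans F F :=
  NatTrans (@nt_id_natural F).

Lemma nt_comp_natural (F G H : functor C D) (t : nat_trans G H)
    (s : nat_trans F G) (A B : C) (f : hom A B) :
  comp (comp (t B) (s B)) (fmap F f) = comp (fmap H f) (comp (t A) (s A)).
Proof. by rewrite -compA nt_natural compA nt_natural compA. Qed.

Definition nt_comp (F G H : functor C D) (t : nat_trans G H)
  (s : nat_trans F G) : nat_trans F H := NatTrans (nt_comp_natural t s).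

Lemma nt_comp1c (F G : functor C D) (s : nat_trans F G) :
  nt_comp (nt_id G) s = s.
Proof. by apply: nat_trans_ext => A /=; rewrite comp1c. Qed.

Lemma nt_compc1 (F G : functor C D) (s : nat_trans F G) :
  nt_comp s (nt_id F) = s.
Proof. by apply: nat_trans_ext => A /=; rewrite compc1. Qed.

Lemma nt_compA (F G H K : functor C D) (u : nat_trans H K)
    (t : nat_trans G H) (s : nat_trans F G) :
  nt_comp u (nt_comp t s) = nt_comp (nt_comp u t) s.
Proof. by apply: nat_trans_ext => A /=; rewrite compA. Qed.

Definition functor_category : category :=
  Category nt_comp1c nt_compc1 nt_compA.

Definition isomorphic_functors (F G : functor C D) : Prop :=
  exists (s : nat_trans F G) (t : nat_trans G F),
    nt_comp t s = nt_id F /\ nt_comp s t = nt_id G.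
End NatTrans.

Definition equivalent_categories (C D : category) : Prop :=
  exists (F : functor C D) (G : functor D C),
    isomorphic_functors (functor_comp G F) (id_functor C) /\
    isomorphic_functors (functor_comp F G) (id_functor D).

Record zero_object (C : category) := ZeroObject {
  zob :> C;
  zfrom : forall A : C, hom zob A;
  zto : forall A : C, hom A zob;
  zfrom_uniq : forall (A : C) (f : hom zob A), f = zfrom A;
  zto_uniq : forall (A : C) (f : hom A zob), f = zto A }.

Definition zero_mor (C : category) (Z : zero_object C) (A B : C) : hom A B :=
  comp (zfrom Z B) (zto Z A).

Record finite_coproducts (C : category) := FiniteCoproducts {
  cop : forall m, ('I_m -> C) -> C;
  cinj : forall m (X : 'I_m -> C) (i : 'I_m), hom (X i) (cop X);
  copair : forall m (X : 'I_m -> C) (B : C),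
      (forall i, hom (X i) B) -> hom (cop X) B;
  copairE : forall m (X : 'I_m -> C) (B : C) (f : forall i, hom (X i) B) i,
      comp (copair f) (cinj X i) = f i;
  copair_uniq : forall m (X : 'I_m -> C) (B : C) (f g : hom (cop X) B),
      (forall i, comp f (cinj X i) = comp g (cinj X i)) -> f = g }.
Arguments cop {C} f {m} X : rename.
Arguments cinj {C} f {m} X i : rename.
Arguments copair {C} f {m X B} h : rename.

Section CrossEffects.
Variables (C : category) (Z : zero_object C) (K : finite_coproducts C).

(* The component on X i of the retraction from the coproduct of X onto the
   coproduct of the X j with j != k: it is zero for i = k. *)
Definition kill_comp m (X : 'I_m -> C) (k i : 'I_m) :
    hom (X i) (cop K (fun j => X (lift k j))) :=
  match unliftP k i with
  | UnliftSome j e => ecast i' (hom (X i') (cop K (fun j => X (lift k j))))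
                        (esym e) (cinj K (fun j => X (lift k j)) j)
  | UnliftNone _ => zero_mor Z _ _
  end.

Definition retraction m (X : 'I_m -> C) (k : 'I_m) :
    hom (cop K X) (cop K (fun j => X (lift k j))) :=
  copair K (kill_comp X k).

Lemma retraction_eq m (X : 'I_m -> C) (k : 'I_m) :
  comp (retraction X k) (cinj K X k) = zero_mor Z _ _.
Proof.
rewrite copairE /kill_comp; case: unliftP => // j e.
by case/eqP: (neq_lift k j).
Qed.

Lemma retraction_neq m (X : 'I_m -> C) (k : 'I_m) j :
  comp (retraction X k) (cinj K X (lift k j)) =
  cinj K (fun j => X (lift k j)) j.
Proof.
rewrite copairE /kill_comp; case: unliftP => [j' e | e]; last first.
  by case/eqP: (neq_lift k j); rewrite e.
have ej : j = j' by apply: (@lift_inj _ k).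
by case: _ / ej in e *; rewrite (Prop_irrelevance e erefl).
Qed.
End CrossEffects.

Lemma additive_ext (A B : zmodType) (f g : {additive A -> B}) :
  f =1 g -> f = g.
Proof.
case: f g => f [[f1]] [g [[g1]]] /= /funext e.
by case: _ / e in g1 *; congr GRing.Additive.Pack;
  congr GRing.Additive.Class;
  congr GRing.isNmodMorphism.Axioms_; apply: Prop_irrelevance.
Qed.

Definition ab_id (A : zmodType) : {additive A -> A} := idfun.

Definition ab_comp (A B C : zmodType) (g : {additive B -> C})
  (f : {additive A -> B}) : {additive A -> C} := g \o f.

Lemma ab_comp1c (A B : zmodType) (f : {additive A -> B}) :
  ab_comp (ab_id B) f = f.
Proof. exact: additive_ext. Qed.

Lemma ab_compc1 (A B : zmodType) (f : {additive A -> B}) :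
  ab_comp f (ab_id A) = f.
Proof. exact: additive_ext. Qed.

Lemma ab_compA (A B C D : zmodType) (h : {additive C -> D})
    (g : {additive B -> C}) (f : {additive A -> B}) :
  ab_comp h (ab_comp g f) = ab_comp (ab_comp h g) f.
Proof. exact: additive_ext. Qed.

Definition Ab : category := Category ab_comp1c ab_compc1 ab_compA.

Coercion ab_zmod (A : Ab) : zmodType := A.

Section Polynomial.
Variables (C : category) (Z : zero_object C) (K : finite_coproducts C).
Variable F : functor C Ab.

Definition is_trivial (A : Ab) : Prop := forall x : A, x = 0%R.

Definition reduced : Prop := is_trivial (F Z).

(* The subgroup cr_m F (X_1, ..., X_m) of F (X_1 \/ ... \/ X_m). *)
Definition cross_effect m (X : 'I_m -> C) (x : F (cop K X)) : Prop :=
  forall k : 'I_m, fmap F (retraction Z K X k) x = 0%R.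

Definition polynomial_of_degree_le (n : nat) : Prop :=
  forall (X : 'I_n.+1 -> C) (x : F (cop K X)), cross_effect x -> x = 0%R.
End Polynomial.

Section MatchPerm.
Variables (T : eqType) (n : nat).

(* The permutation s with y_(s k) = x_k, when there is one. *)
Definition match_perm (x y : 'I_n -> T) : 'S_n :=
  odflt 1%g [pick s : 'S_n | [forall k, y (s k) == x k]].

Lemma match_permE (x y : 'I_n -> T) :
  injective x -> (forall k, exists l, y l = x k) ->
  forall k, y (match_perm x y k) = x k.
Proof.
move=> injx yx; rewrite /match_perm; case: pickP => [s /forallP h k|].
  exact/eqP/h.
have {}yx k : exists l, y l == x k by have [l /eqP ?] := yx k; exists l.
have injs : injective (fun k => xchoose (yx k)).
  move=> k k' /(congr1 y).
  by rewrite (eqP (xchooseP (yx k))) (eqP (xchooseP (yx k'))) => /injx.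
move=> /(_ (perm injs)) /negP[]; apply/forallP => k.
by rewrite permE; exact: (xchooseP (yx k)).
Qed.
End MatchPerm.

(* Positions of an operation in P(m_1 + ... + m_n) are elements of
   'I_(\sum_i m i); [tagnat.Rank i t] is position t of block i. *)
Notation blk l := (tagnat.sig1 l).
Notation pos l := (tagnat.sig2 l).

Definition concat (X : Type) n (m : 'I_n -> nat) (x : forall i, 'I_(m i) -> X) :
  'I_(\sum_i m i) -> X := fun l => x (blk l) (pos l).

Definition transport (F : nat -> Type) n m (e : n = m) (p : F n) : F m :=
  ecast k (F k) e p.

Lemma transport_id (F : nat -> Type) n (e : n = n) (p : F n) :
  transport e p = p.
Proof. by rewrite (eq_irrelevance e erefl). Qed.

(* s_1 (+) ... (+) s_n, acting by s_i on block i. *)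
Section SumPerm.
Variables (n : nat) (m : 'I_n -> nat) (s : forall i, 'S_(m i)).

Definition sum_perm_fun (l : 'I_(\sum_i m i)) : 'I_(\sum_i m i) :=
  tagnat.Rank (blk l) (s (blk l) (pos l)).

Lemma sum_perm_inj : injective sum_perm_fun.
Proof.
move=> k l; rewrite -(tagnat.sig2K k) -(tagnat.sig2K l).
move: (blk k) (pos k) (blk l) (pos l) => i t j u.
have E i' t' : sum_perm_fun (@tagnat.Rank n m i' t') = tagnat.Rank i' (s i' t').
  rewrite /sum_perm_fun /tagnat.sig1 /tagnat.sig2 /tagnat.Rank.
  by rewrite tagnat.rankK.
rewrite !E => /(congr1 val)/eqP; rewrite tagnat.eq_Rank => /andP[/eqP ij].
by case: _ / ij in u * => /eqP/val_inj/perm_inj ->.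
Qed.

Definition sum_perm : 'S_(\sum_i m i) := perm sum_perm_inj.
End SumPerm.

Section BlockPerm.
Variables (n : nat) (s : 'S_n) (m : 'I_n -> nat).

Lemma sum_reindex_perm : \sum_i m ((s^-1)%g i) = \sum_i m i.
Proof. by rewrite [RHS](reindex_inj (@perm_inj _ (s^-1)%g)). Qed.

(* The permutation moving block i of (m_1, ..., m_n) onto block s(i) of
   (m_(s^-1 1), ..., m_(s^-1 n)). *)
Definition block_perm : 'S_(\sum_i m i) :=
  match_perm (fun k => (blk k, val (pos k)))
    (fun l => let l' := cast_ord (esym sum_reindex_perm) l in
      ((s^-1)%g (blk l'), val (pos l'))).
End BlockPerm.

Lemma sum_block_assoc n (m : 'I_n -> nat) (r : 'I_(\sum_i m i) -> nat) :
  \sum_l r l = \sum_i \sum_(j < m i) r (tagnat.Rank i j).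
Proof.
rewrite sig_big_dep /= (reindex (@tagnat.rank n m)) /=.
  by apply: eq_big => // -[i j] _; rewrite tagnat.rankE.
exact: tagnat.rank_bij_on.
Qed.

Lemma sum_ones n : \sum_(i < n) 1 = n.
Proof. by rewrite sum1_card card_ord. Qed.

(* Right actions are taken with respect to composition of permutations as
   functions: p.(s o t) = (p.s).t, where s o t is [(t * s)%g] in MathComp. *)
Record operad := Operad {
  op :> nat -> Type;
  act : forall n, op n -> 'S_n -> op n;
  op1 : op 1;
  gam : forall n (m : 'I_n -> nat), op n -> (forall i, op (m i)) ->
      op (\sum_i m i);
  act1 : forall n (p : op n), act p 1%g = p;
  actM : forall n (p : op n) (s t : 'S_n), act (act p s) t = act p (t * s)%g;
  gam1l : forall n (p : op n),
      transport (big_ord1 _ _) (gam (m := fun _ : 'I_1 => n) op1 (fun _ => p))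
      = p;
  gam1r : forall n (p : op n),
      transport (sum_ones n) (gam p (fun _ => op1)) = p;
  gamA : forall n (m : 'I_n -> nat) (r : 'I_(\sum_i m i) -> nat)
      (p : op n) (q : forall i, op (m i)) (u : forall l, op (r l)),
      transport (sum_block_assoc r) (gam (gam p q) u) =
      gam p (fun i => gam (q i) (fun j => u (tagnat.Rank i j)));
  gam_actl : forall n (m : 'I_n -> nat) (p : op n) (s : 'S_n)
      (q : forall i, op (m i)),
      gam (act p s) q =
      act (transport (sum_reindex_perm s m) (gam p (fun i => q ((s^-1)%g i))))
        (block_perm s m);
  gam_actr : forall n (m : 'I_n -> nat) (p : op n) (q : forall i, op (m i))
      (s : forall i, 'S_(m i)),
      gam p (fun i => act (q i) (s i)) = act (gam p q) (sum_perm s) }.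
Arguments act {o n} p s : rename.
Arguments op1 {o}.
Arguments gam {o n m} p q : rename.

Record unitary (P : operad) := Unitary {
  op0 : P 0;
  op0_uniq : forall p : P 0, p = op0 }.

Record algebra (P : operad) := Algebra {
  car :> Type;
  mu : forall n, P n -> ('I_n -> car) -> car;
  mu_act : forall n (p : P n) (s : 'S_n) (x : 'I_n -> car),
      mu (act p s) x = mu p (fun i => x ((s^-1)%g i));
  mu1 : forall x : car, mu op1 (fun _ => x) = x;
  muA : forall n (m : 'I_n -> nat) (p : P n) (q : forall i, P (m i))
      (x : forall i, 'I_(m i) -> car),
      mu p (fun i => mu (q i) (x i)) = mu (gam p q) (concat x) }.
Arguments mu {P a n} p x : rename.

Section AlgebraCategory.
Variable P : operad.

Record alg_hom (A B : algebra P) := AlgHom {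
  afun :> A -> B;
  afun_mu : forall n (p : P n) (x : 'I_n -> A),
      afun (mu p x) = mu p (fun i => afun (x i)) }.

Lemma alg_hom_ext (A B : algebra P) (f g : alg_hom A B) : f =1 g -> f = g.
Proof.
case: f g => f hf [g hg] /= /funext e.
by case: _ / e in hg *; congr AlgHom; apply: Prop_irrelevance.
Qed.

Definition alg_id (A : algebra P) : alg_hom A A :=
  @AlgHom A A id (fun _ _ _ => erefl).

Lemma alg_comp_mu (A B C : algebra P) (g : alg_hom B C) (f : alg_hom A B)
    n (p : P n) (x : 'I_n -> A) : g (f (mu p x)) = mu p (fun i => g (f (x i))).
Proof. by rewrite !afun_mu. Qed.

Definition alg_comp (A B C : algebra P) (g : alg_hom B C) (f : alg_hom A B) :
  alg_hom A C := @AlgHom A C (fun a => g (f a)) (alg_comp_mu g f).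

Lemma alg_comp1c (A B : algebra P) (f : alg_hom A B) :
  alg_comp (alg_id B) f = f.
Proof. exact: alg_hom_ext. Qed.

Lemma alg_compc1 (A B : algebra P) (f : alg_hom A B) :
  alg_comp f (alg_id A) = f.
Proof. exact: alg_hom_ext. Qed.

Lemma alg_compA (A B C D : algebra P) (h : alg_hom C D) (g : alg_hom B C)
    (f : alg_hom A B) : alg_comp h (alg_comp g f) = alg_comp (alg_comp h g) f.
Proof. exact: alg_hom_ext. Qed.

Definition alg_category : category := Category alg_comp1c alg_compc1 alg_compA.
End AlgebraCategory.

Lemma Rank_eq n (m : 'I_n -> nat) (l : 'I_(\sum_i m i)) i (t : 'I_(m i)) :
  l = tagnat.Rank i t -> blk l = i /\ val (pos l) = t.
Proof.
move=> ->; split; first by rewrite tagnat.Rank1K.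
by rewrite tagnat.Rank2K.
Qed.

Lemma pos_ext (X : Type) n (m : 'I_n -> nat) (x : forall i, 'I_(m i) -> X)
  i j (t : 'I_(m i)) (u : 'I_(m j)) : i = j -> val t = val u -> x i t = x j u.
Proof. by move=> e; case: _ / e in u * => /val_inj ->. Qed.

Lemma concat_Rank (X : Type) n (m : 'I_n -> nat) (x : forall i, 'I_(m i) -> X)
  i (t : 'I_(m i)) : concat x (tagnat.Rank i t) = x i t.
Proof. by have [] := Rank_eq (erefl (tagnat.Rank i t)); apply: pos_ext. Qed.

Lemma sum_permE n (m : 'I_n -> nat) (s : forall i, 'S_(m i)) i t :
  sum_perm s (tagnat.Rank i t) = tagnat.Rank i (s i t).
Proof.
rewrite permE /sum_perm_fun /tagnat.sig1 /tagnat.sig2 /tagnat.Rank.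
by rewrite tagnat.rankK.
Qed.

Lemma block_permE n (s : 'S_n) (m : 'I_n -> nat) k
    (l := cast_ord (esym (sum_reindex_perm s m)) (block_perm s m k)) :
  (s^-1)%g (blk l) = blk k /\ val (pos l) = val (pos k).
Proof.
rewrite {}/l.
pose x (k : 'I_(\sum_i m i)) := (blk k, val (pos k)).
pose y l := let l' := cast_ord (esym (sum_reindex_perm s m)) l in
  ((s^-1)%g (blk l'), val (pos l')).
suff: y (match_perm x y k) = x k by case.
move: k; apply: match_permE => [k l [e1 e2]|k].
  rewrite -(tagnat.sig2K k) -(tagnat.sig2K l); apply/val_inj/eqP.
  by rewrite tagnat.eq_Rank; apply/andP; split; apply/eqP.
have e : m (blk k) = m ((s^-1)%g (s (blk k))) by rewrite permK.
exists (cast_ord (sum_reindex_perm s m)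
  (@tagnat.Rank _ (fun i => m ((s^-1)%g i)) (s (blk k)) (cast_ord e (pos k)))).
rewrite /y /= cast_ordK.
have [e1 e2] := Rank_eq (erefl (@tagnat.Rank _ (fun i => m ((s^-1)%g i))
  (s (blk k)) (cast_ord e (pos k)))).
by congr pair; [rewrite -[RHS](permK s); congr (_ _) | exact: e2].
Qed.

Lemma ltn_Rank n (m : 'I_n -> nat) i i' (t : 'I_(m i)) (t' : 'I_(m i')) :
  i < i' -> tagnat.Rank i t < tagnat.Rank i' t'.
Proof.
move=> ii'; rewrite !tagnat.RankEsum.
apply: leq_trans (leq_addr _ _); rewrite [leqRHS](bigD1 i) //=.
rewrite addnC -addSn leq_add //.
rewrite [leqLHS](eq_bigl (fun k : 'I_n => (k < i' ) && (k != i) && (k < i))).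
  by rewrite big_mkcondr; apply: leq_sum => k _; case: ifP.
move=> k; case: (ltnP k i) => [ki|]; last by rewrite andbF.
by rewrite (ltn_trans ki ii') andbT /= -val_eqE /= neq_ltn ki.
Qed.

Lemma sum_ltn_Rank n (m : 'I_n -> nat) (r : 'I_(\sum_i m i) -> nat)
    i (t : 'I_(m i)) :
  \sum_(k < \sum_i m i | k < tagnat.Rank i t) r k =
  \sum_(i' < n | i' < i) \sum_(t' < m i') r (tagnat.Rank i' t')
  + \sum_(t' < m i | t' < t) r (tagnat.Rank i t').
Proof.
have [v hv] : exists v : forall i', 'I_(m i') -> nat,
    forall i' t', v i' t' = tagnat.Rank i' t' by eexists.
rewrite (reindex (@tagnat.rank n m)) /=; last first.
  by apply: onW_bij; apply: tagnat.rank_bij.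
transitivity (\sum_i' \sum_(t' : 'I_(m i') | v i' t' < v i t)
    r (tagnat.Rank i' t')).
  rewrite sig_big_dep /=; by apply: eq_big => [[i' t']|[i' t'] _]; rewrite ?hv.
rewrite (bigD1 i) //= addnC; congr (_ + _); last first.
  by apply: eq_bigl => t'; rewrite !hv !tagnat.RankEsum ltn_add2l.
rewrite (bigID (fun i' : 'I_n => i' < i)) /= [X in _ + X]big1 ?addn0.
  apply: eq_big => [i'|i' /andP[_ ii']].
    by rewrite -val_eqE /=; case: ltngtP.
  by apply: eq_bigl => t'; rewrite !hv ltn_Rank.
move=> i' /andP[ni ii']; rewrite big1 // => t'.
rewrite !hv ltnNge ltnW // ltn_Rank //.
by rewrite ltn_neqAle leqNgt ii' andbT eq_sym val_eqE.
Qed.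

Lemma Rank_assoc n (m : 'I_n -> nat) (r : 'I_(\sum_i m i) -> nat)
    i (j : 'I_(m i)) (t : 'I_(r (tagnat.Rank i j))) :
  cast_ord (sum_block_assoc r) (tagnat.Rank (tagnat.Rank i j) t) =
  @tagnat.Rank _ (fun i => \sum_(j < m i) r (tagnat.Rank i j)) i
    (@tagnat.Rank _ (fun j => r (tagnat.Rank i j)) j t).
Proof.
apply: ord_inj; rewrite -[LHS]/(nat_of_ord (tagnat.Rank (tagnat.Rank i j) t)).
by rewrite tagnat.RankEsum sum_ltn_Rank !tagnat.RankEsum addnA.
Qed.

Section FreeAlgebra.
Local Open Scope quotient_scope.
Variables (P : operad) (X : Type).

(* Elements of the coproduct over n of P(n) x X^n. *)
Definition word : choiceType := {classic {n : nat & (P n * ('I_n -> X))%type}}.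

Definition mkword n (p : P n) (x : 'I_n -> X) : word :=
  existT (fun n => (P n * ('I_n -> X))%type) n (p, x).

(* (p.s, x_1, ..., x_n) ~ (p, x_(s^-1 1), ..., x_(s^-1 n)) *)
Definition word_rel (a b : word) : Prop :=
  exists n (p : P n) (s : 'S_n) (x : 'I_n -> X),
    a = mkword (act p s) x /\ b = mkword p (fun i => x ((s^-1)%g i)).

Lemma mkword_inj n (p q : P n) (x y : 'I_n -> X) :
  mkword p x = mkword q y -> p = q /\ x = y.
Proof.
move=> h.
have H (a b : word) (e : a = b) (e1 : projT1 a = projT1 b) :
    transport (F := fun n => (P n * ('I_n -> X))%type) e1 (projT2 a) = projT2 b.
  by case: _ / e in e1 *; rewrite transport_id.
by have := H _ _ h erefl; rewrite transport_id => -[].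
Qed.

Lemma word_rel_refl a : word_rel a a.
Proof.
case: a => n [p x]; exists n, p, 1%g, x; rewrite act1; split=> //.
by congr mkword; apply/funext => i; rewrite invg1 perm1.
Qed.

Lemma word_rel_sym a b : word_rel a b -> word_rel b a.
Proof.
move=> [n] [p] [s] [x] [-> ->].
exists n, (act p s), (s^-1)%g, (fun i => x ((s^-1)%g i)); split.
  by rewrite actM mulVg act1.
by congr mkword; apply/funext => i; rewrite invgK permK.
Qed.

Lemma word_rel_trans a b c : word_rel a b -> word_rel b c -> word_rel a c.
Proof.
move=> [n] [p] [s] [x] [-> ->] [n'] [p'] [s'] [x'] [e ->].
have en : n = n' := congr1 (@projT1 _ _) e.
case: _ / en in p' s' x' e *.
have [-> <-] := mkword_inj e.
exists n, p', (s * s')%g, x; rewrite actM; split=> //.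
by congr mkword; apply/funext => i; rewrite invMg permM.
Qed.

Lemma word_rel_equiv : equiv_class_of (fun a b : word => `[< word_rel a b >]).
Proof.
split=> [a|a b|b a c]; first exact/asboolP/word_rel_refl.
  by apply/asbool_equiv_eq; split; apply: word_rel_sym.
by move=> /asboolP ab /asboolP bc; apply/asboolP; apply: word_rel_trans ab bc.
Qed.

Definition word_equiv : equiv_rel word := EquivRelPack word_rel_equiv.

Definition free_car : Type := {eq_quot word_equiv}.

Definition cls n (p : P n) (x : 'I_n -> X) : free_car :=
  \pi_{eq_quot word_equiv} (mkword p x).

Definition wrep (a : free_car) : word := repr (a : {eq_quot word_equiv}).
Definition war (a : free_car) : nat := tag (wrep a).
Definition wop (a : free_car) : P (war a) := (tagged (wrep a)).1.
Definition wlet (a : free_car) : 'I_(war a) -> X := (tagged (wrep a)).2.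

Lemma wrepK a : cls (wop a) (@wlet a) = a.
Proof.
rewrite -[RHS]reprK /cls /wop /wlet /war /wrep /mkword.
by case: (repr _) => n [p x].
Qed.

Lemma clsP n (p q : P n) (x y : 'I_n -> X) :
  cls p x = cls q y <->
  exists s : 'S_n, p = act q s /\ y = fun i => x ((s^-1)%g i).
Proof.
split=> [/eqmodP /asboolP|[s [-> ->]]]; last first.
  by apply/eqmodP/asboolP; exists n, q, s, x.
move=> [n'] [p'] [s] [x'] [e1 e2].
have en : n = n' := congr1 (@projT1 _ _) e1.
case: _ / en in p' s x' e1 e2 *.
have [-> ->] := mkword_inj e1; have [-> ->] := mkword_inj e2.
by exists s.
Qed.

Lemma cls_arity n n' (p : P n) (p' : P n') (x : 'I_n -> X) (x' : 'I_n' -> X) :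
  cls p x = cls p' x' -> n = n'.
Proof.
move=> /eqmodP /asboolP [k] [q] [s] [y] [e1 e2].
by rewrite (congr1 (@projT1 _ _) e1 : n = k) (congr1 (@projT1 _ _) e2 : n' = k).
Qed.

Lemma cls_act n (p : P n) (s : 'S_n) (x : 'I_n -> X) :
  cls (act p s) x = cls p (fun i => x ((s^-1)%g i)).
Proof. by apply/clsP; exists s. Qed.

Lemma cls_transport n n' (e : n = n') (p : P n) (x : 'I_n' -> X) :
  cls (transport e p) x = cls p (fun i => x (cast_ord e i)).
Proof.
case: _ / e in x *; rewrite transport_id; congr cls.
by apply/funext => i; rewrite cast_ord_id.
Qed.

Lemma cls_ext n (p : P n) (x y : 'I_n -> X) : x =1 y -> cls p x = cls p y.
Proof. by move=> /funext ->. Qed.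

Definition free_mu n (p : P n) (a : 'I_n -> free_car) : free_car :=
  cls (gam p (fun i => wop (a i))) (concat (fun i => @wlet (a i))).

Lemma cls_gam n (p : P n) (m m' : 'I_n -> nat)
    (q : forall i, P (m i)) (x : forall i, 'I_(m i) -> X)
    (q' : forall i, P (m' i)) (x' : forall i, 'I_(m' i) -> X) :
  (forall i, cls (q i) (x i) = cls (q' i) (x' i)) ->
  cls (gam p q) (concat x) = cls (gam p q') (concat x').
Proof.
move=> e; have em : m = m' by apply/funext => i; apply: cls_arity (e i).
case: _ / em in q' x' e *.
pose S i := cid ((clsP _ _ _ _).1 (e i)).
pose s i := projT1 (S i); have hs i := projT2 (S i).
have -> : q = fun i => act (q' i) (s i).
  by apply: functional_extensionality_dep => i; case: (hs i).
rewrite gam_actr cls_act; apply: cls_ext => l.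
rewrite -(tagnat.sig2K l); move: (blk l) (pos l) => i t.
rewrite -[t](permKV (s i)) -sum_permE permK sum_permE !concat_Rank.
by have [_ ->] := hs i; rewrite permK.
Qed.

Lemma free_muE n (m : 'I_n -> nat) (p : P n) (q : forall i, P (m i))
    (x : forall i, 'I_(m i) -> X) :
  free_mu p (fun i => cls (q i) (x i)) = cls (gam p q) (concat x).
Proof. by apply: cls_gam => i; rewrite wrepK. Qed.

Lemma free_mu_act n (p : P n) (s : 'S_n) (a : 'I_n -> free_car) :
  free_mu (act p s) a = free_mu p (fun i => a ((s^-1)%g i)).
Proof.
rewrite /free_mu gam_actl cls_act cls_transport; apply: cls_ext => l.
set m := fun i => war (a i) in l *.
set k := ((block_perm s m)^-1)%g _.
have ek : block_perm s m k = cast_ord (sum_reindex_perm s m) l by rewrite permKV.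
have := block_permE s k; rewrite ek cast_ordK => -[e1 e2].
exact: (@pos_ext _ _ m (fun i => @wlet (a i))) (esym e1) (esym e2).
Qed.

Definition eta (x : X) : free_car := cls op1 (fun _ => x).

Lemma free_mu1 (a : free_car) : free_mu op1 (fun _ => a) = a.
Proof.
rewrite -[a in LHS]wrepK free_muE -[RHS]wrepK -[wop a in RHS]gam1l.
rewrite cls_transport; apply: cls_ext => l; congr wlet.
apply: val_inj; apply/esym/(etrans (tagnat.rect l)).
rewrite [X in X + _ = _]big1 ?add0n // => i.
by rewrite (ord1 (blk l)) ltn0.
Qed.

Lemma free_muA n (m : 'I_n -> nat) (p : P n) (q : forall i, P (m i))
    (x : forall i, 'I_(m i) -> free_car) :
  free_mu p (fun i => free_mu (q i) (x i)) = free_mu (gam p q) (concat x).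
Proof.
have -> : x = fun i j => concat x (tagnat.Rank i j).
  apply: functional_extensionality_dep => i; apply/funext => j.
  by rewrite concat_Rank.
have -> : concat (fun i j => concat x (tagnat.Rank i j)) = concat x.
  by apply/funext => l; rewrite {1}/concat tagnat.sig2K.
move: (concat x) => {}x.
transitivity (cls (gam p (fun i => gam (q i) (fun j => wop (x (tagnat.Rank i j)))))
   (concat (fun i => concat (fun j => @wlet (x (tagnat.Rank i j)))))).
  exact: free_muE.
rewrite -(gamA _ _ (fun l => wop (x l))) cls_transport /free_mu.
apply: cls_ext => l; rewrite -(tagnat.sig2K l); move: (blk l) (pos l) => L.
rewrite -(tagnat.sig2K L); move: (blk L) (pos L) => i j t.
by rewrite Rank_assoc !concat_Rank.
Qed.

Definition free_algebra : algebra P := Algebra free_mu_act free_mu1 free_muA.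

End FreeAlgebra.

Section FreeExtension.
Variable P : operad.

Section Ext.
Variables (X : Type) (B : algebra P) (h : X -> B).

Definition fext_fun (a : free_algebra P X) : B :=
  mu (wop a) (fun i => h (wlet (a := a) i)).

Lemma fext_cls n (p : P n) (x : 'I_n -> X) :
  fext_fun (cls p x) = mu p (fun i => h (x i)).
Proof.
have e : cls (wop (cls p x)) (@wlet _ _ (cls p x)) = cls p x := wrepK _.
rewrite /fext_fun.
move: (war (cls p x)) (wop (cls p x)) (@wlet _ _ (cls p x)) e => k q y e.
have ek := cls_arity e; case: _ / ek in p x e *.
by have [s [-> ->]] := (clsP _ _ _ _).1 e; rewrite mu_act.
Qed.

Lemma fext_mu n (p : P n) (a : 'I_n -> free_algebra P X) :
  fext_fun (mu p a) = mu p (fun i => fext_fun (a i)).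
Proof.
rewrite -[mu p a]/(free_mu p a) /free_mu fext_cls.
exact: esym (muA p _ (fun i t => h (wlet (a := a i) t))).
Qed.

Definition fext : alg_hom (free_algebra P X) B := AlgHom fext_mu.

Lemma fext_eta (x : X) : fext (eta P x) = h x.
Proof. by rewrite /= fext_cls mu1. Qed.
End Ext.

Lemma cls_mu (X : Type) n (p : P n) (x : 'I_n -> X) :
  cls p x = mu (a := free_algebra P X) p (fun i => eta P (x i)).
Proof.
rewrite [RHS]free_muE -[p in LHS]gam1r cls_transport; apply: cls_ext => l.
rewrite /concat; congr x; apply: ord_inj => /=.
rewrite [LHS](tagnat.rect l) (ord1 (pos l)) addn0.
by rewrite -(big_ord_widen n (fun _ => 1)) ?sum_ones // ltnW.
Qed.

Lemma free_hom_ext (X : Type) (B : algebra P)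
    (f g : alg_hom (free_algebra P X) B) :
  (forall x, f (eta P x) = g (eta P x)) -> f = g.
Proof.
move=> e; apply: alg_hom_ext => a; rewrite -[a]wrepK cls_mu !afun_mu.
by congr mu; apply/funext => i.
Qed.

Lemma fext_id (X : Type) :
  fext (B := free_algebra P X) (@eta P X) = alg_id (free_algebra P X).
Proof. by apply: free_hom_ext => x; rewrite fext_eta. Qed.

Lemma fext_fext (X Y : Type) (B : algebra P) (h : X -> free_algebra P Y)
    (k : Y -> B) :
  alg_comp (fext k) (fext h) = fext (fun x => fext k (h x)).
Proof.
apply: free_hom_ext => x.
by rewrite fext_eta; apply: (congr1 (fext k) (fext_eta h x)).
Qed.
End FreeExtension.

Section FreeCategory.
Variable P : operad.

Definition free_category : category :=
  @full_sub (alg_category P) nat (fun n => free_algebra P 'I_n).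

Definition free_inj m (X : 'I_m -> free_category) (i : 'I_m) :
    @hom free_category (X i) (\sum_j X j) :=
  fext (B := free_algebra P 'I_(\sum_j X j))
    (fun t : 'I_(X i) => eta P (tagnat.Rank i t)).

Lemma free_injE m (X : 'I_m -> free_category) i (t : 'I_(X i)) :
  (free_inj X i : alg_hom (free_algebra P 'I_(X i))
     (free_algebra P 'I_(\sum_j X j))) (eta P t) = eta P (tagnat.Rank i t).
Proof. exact: fext_eta. Qed.

Definition free_copair m (X : 'I_m -> free_category) (B : free_category)
    (f : forall i, hom (X i) B) : @hom free_category (\sum_j X j) B :=
  fext (B := free_algebra P 'I_B)
    (concat (fun i t => (f i : alg_hom _ _) (eta P t))).

Lemma free_copairE m (X : 'I_m -> free_category) (B : free_category)
    (f : forall i, hom (X i) B) i : comp (free_copair f) (free_inj X i) = f i.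
Proof.
apply: free_hom_ext => t.
apply: (etrans (congr1 (fext _) (fext_eta _ _))); rewrite fext_eta.
exact: (concat_Rank (fun i t => (f i : alg_hom _ _) (eta P t))).
Qed.

Lemma free_copair_uniq m (X : 'I_m -> free_category) (B : free_category)
    (f g : @hom free_category (\sum_j X j) B) :
  (forall i, comp f (free_inj X i) = comp g (free_inj X i)) -> f = g.
Proof.
move=> e; apply: free_hom_ext => l; rewrite -(tagnat.sig2K l).
have fg := congr1 (fun h : alg_hom (free_algebra P 'I_(X (blk l)))
  (free_algebra P 'I_B) => h (eta P (pos l))) (e (blk l)).
have E := free_injE (pos l).
pose F : alg_hom (free_algebra P 'I_(\sum_j X j)) (free_algebra P 'I_B) := f.
pose G : alg_hom (free_algebra P 'I_(\sum_j X j)) (free_algebra P 'I_B) := g.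
exact: (etrans (congr1 F (esym E)) (etrans fg (congr1 G E))).
Qed.

Definition free_coproducts : finite_coproducts free_category :=
  FiniteCoproducts free_copairE free_copair_uniq.

Variable U : unitary P.

Lemma free0_uniq (a b : free_algebra P 'I_0) : a = b.
Proof.
suff H (c : free_algebra P 'I_0) : c = cls (op0 U) (fun i => i) by rewrite (H a) (H b).
rewrite -[c]wrepK; move: (war c) (wop c) (@wlet P 'I_0 c) => [|k] p x; last first.
  by have := ltn_ord (x ord0).
by rewrite (op0_uniq U p); apply: cls_ext => -[].
Qed.

Definition free_from0 (A : free_category) : @hom free_category 0 A :=
  fext (B := free_algebra P 'I_A) (fun i : 'I_0 => False_rect _ (notF (ltn_ord i))).

Lemma free_from0_uniq (A : free_category) (f : @hom free_category 0 A) :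
  f = free_from0 A.
Proof. by apply: free_hom_ext => -[]. Qed.

Definition free_to0 (A : free_category) : @hom free_category A 0 :=
  @AlgHom P (free_algebra P 'I_A) (free_algebra P 'I_0)
    (fun _ => cls (op0 U) (fun i => i)) (fun _ _ _ => free0_uniq _ _).

Lemma free_to0_uniq (A : free_category) (f : @hom free_category A 0) :
  f = free_to0 A.
Proof. by apply: alg_hom_ext => a; apply: free0_uniq. Qed.

Definition free_zero : zero_object free_category :=
  ZeroObject free_from0_uniq free_to0_uniq.

Definition reduced_polynomial_functors (n : nat) : category :=
  @full_sub (functor_category free_category Ab)
    {F : functor free_category Ab |
      reduced free_zero F /\
      polynomial_of_degree_le free_zero free_coproducts F n}
    (fun F => sval F).
End FreeCategory.

Definition fib n m (f : 'I_n -> 'I_m) (y : 'I_m) : {set 'I_n} :=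
  [set x | f x == y].

(* [enum_val] lists the elements of a subset of 'I_n in increasing order. *)
Notation fib_val f y := (@enum_val _ (pred_of_set (fib f y))).

Lemma fib_rank n m (f : 'I_n -> 'I_m) y x : f x = y ->
  exists k, fib_val f y k = x.
Proof.
move=> fx; have xf : x \in fib f y by rewrite inE fx.
by exists (enum_rank_in xf x); rewrite enum_rankK_in.
Qed.

Lemma fib_valP n m (f : 'I_n -> 'I_m) y k : f (fib_val f y k) = y.
Proof. by have := enum_valP k; rewrite inE => /eqP. Qed.

Lemma card_fib_comp n m l (f : 'I_n -> 'I_m) (g : 'I_m -> 'I_l) (z : 'I_l) :
  \sum_(s < #|fib g z|) #|fib f (fib_val g z s)| = #|fib (fun x => g (f x)) z|.
Proof.
rewrite -(big_enum_val (A := pred_of_set (fib g z)) (fun y => #|fib f y|)) /=.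
rewrite -[RHS]sum1_card (partition_big f (mem (fib g z))) /=; last first.
  by move=> x; rewrite !inE.
apply: eq_bigr => y; rewrite inE => /eqP gy; rewrite -sum1_card.
by apply: eq_bigl => x; rewrite !inE; case: eqP => [->|]; rewrite ?gy ?eqxx ?andbF.
Qed.

Lemma card_fib_inj n m (f : 'I_n -> 'I_m) (finj : injective f) y :
  #|fib f y| <= 1.
Proof.
apply/card_le1_eqP => x x'; rewrite !inE => /eqP fx /eqP fx'.
by apply: finj; rewrite fx fx'.
Qed.

Section SCategory.
Variables (P : operad) (U : unitary P).

Record smor (n m : nat) := SMor {
  sfun :> {ffun 'I_n -> 'I_m};
  sop : forall y : 'I_m, P #|fib sfun y| }.

Section Composition.
Variables (n m l : nat) (g : smor m l) (f : smor n m).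

Definition scomp_fun : {ffun 'I_n -> 'I_l} := [ffun x => g (f x)].

Lemma card_scomp_fib (z : 'I_l) :
  \sum_(s < #|fib g z|) #|fib f (fib_val g z s)| = #|fib scomp_fun z|.
Proof.
rewrite card_fib_comp; apply: eq_card => x.
by rewrite !inE ffunE.
Qed.

(* The elements of the fibre of g o f over z listed fibre by fibre of f. *)
Definition scomp_list (z : 'I_l) : 'I_#|fib scomp_fun z| -> 'I_n :=
  fun k => concat (fun s => fib_val f (fib_val g z s))
    (cast_ord (esym (card_scomp_fib z)) k).

Definition scomp_op (z : 'I_l) : P #|fib scomp_fun z| :=
  act (transport (card_scomp_fib z)
         (gam (sop g z) (fun s => sop f (fib_val g z s))))
    (match_perm (fib_val scomp_fun z) (scomp_list (z := z))).

Definition scomp : smor n l := SMor scomp_op.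

Lemma scomp_permE z k :
  scomp_list (match_perm (fib_val scomp_fun z) (scomp_list (z := z)) k) =
  fib_val scomp_fun z k.
Proof.
move: k; apply: match_permE => [|k]; first exact: enum_val_inj.
have := fib_valP k; rewrite ffunE; move: (fib_val _ _ k) => x gfx.
have [s es] := fib_rank gfx; have [t et] := fib_rank (esym es).
exists (cast_ord (card_scomp_fib z) (@tagnat.Rank _ (fun s =>
  #|fib f (fib_val g z s)|) s t)).
by rewrite /scomp_list cast_ordK concat_Rank.
Qed.
End Composition.

Definition inj_op (r : nat) : r <= 1 -> P r :=
  match r return r <= 1 -> P r with
  | 0 => fun _ => op0 U
  | 1 => fun _ => op1
  | r'.+2 => fun h => False_rect _ (notF h)
  end.

Lemma card_sinj n m (f : 'I_n -> 'I_m) (finj : injective f) y :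
  #|fib (finfun f) y| <= 1.
Proof. by apply: card_fib_inj => x x'; rewrite !ffunE => /finj. Qed.

(* The injection f, decorated with 1_P on its image and 0_P outside it. *)
Definition sinj n m (f : 'I_n -> 'I_m) (finj : injective f) : smor n m :=
  @SMor n m (finfun f) (fun y => inj_op (card_sinj finj y)).

Definition sid n : smor n n := sinj (f := fun x : 'I_n => x) (fun _ _ e => e).

(* (f, w) seen as the family of the elements of the free algebra on the source
   given by the decorated fibres; composition becomes substitution. *)
Definition semb n m (f : smor n m) (y : 'I_m) : free_algebra P 'I_n :=
  cls (sop f y) (fib_val f y).

Lemma semb_comp n m l (g : smor m l) (f : smor n m) z :
  semb (scomp g f) z = fext (semb f) (semb g z).
Proof.
rewrite [RHS]fext_cls [RHS]free_muE [LHS]cls_act cls_transport.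
apply: cls_ext => k; rewrite -scomp_permE permKV.
by rewrite /scomp_list cast_ordK.
Qed.

Lemma cls_supp (X : Type) n (p : P n) (x : 'I_n -> X) n' (p' : P n')
    (x' : 'I_n' -> X) i : cls p x = cls p' x' -> exists j, x' j = x i.
Proof.
move=> e; have en := cls_arity e; case: _ / en in p' x' e *.
by have [s [_ ->]] := (clsP _ _ _ _).1 (esym e); exists ((s^-1)%g i).
Qed.

Lemma semb_inj n m (f g : smor n m) : semb f =1 semb g -> f = g.
Proof.
move=> e; have efun : sfun f = sfun g.
  apply/ffunP => x; have [k ek] := fib_rank (erefl (f x)).
  have [j ej] := cls_supp k (e (f x)).
  by have := fib_valP j; rewrite ej ek => ->.
case: f g e efun => f w [g w'] /= e efun; case: _ / efun in w' e *.
congr SMor; apply: functional_extensionality_dep => y.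
have [s [/= -> es]] := (clsP _ _ _ _).1 (e y).
suff -> : s = 1%g by rewrite act1.
apply/permP => k; rewrite perm1; apply: (@enum_val_inj _ (pred_of_set (fib f y))).
by rewrite [LHS](congr1 (fun h => h (s k)) es) permK.
Qed.

Lemma cls_inj_op (X : Type) r (h : r <= 1) (x : 'I_r -> X) a k :
  x k = a -> cls (inj_op h) x = eta P a.
Proof.
case: r h x k => [|[|r]] h x k; [by have := ltn_ord k | move=> <- | by []].
by apply: cls_ext => i; rewrite (ord1 i) (ord1 k).
Qed.

Lemma semb_id n (y : 'I_n) : semb (sid n) y = eta P y.
Proof.
have [k ek] : exists k, fib_val (sid n) y k = y.
  by apply: fib_rank; rewrite /= ffunE.
exact: cls_inj_op ek.
Qed.

Lemma scomp1c n m (f : smor n m) : scomp (sid m) f = f.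
Proof.
by apply: semb_inj => y; rewrite semb_comp semb_id fext_eta.
Qed.

Lemma scompc1 n m (f : smor n m) : scomp f (sid n) = f.
Proof.
apply: semb_inj => y; rewrite semb_comp.
by have -> : semb (sid n) = @eta P _; [apply/funext => x; rewrite semb_id|
  rewrite fext_id].
Qed.

Lemma scompA n m l k (h : smor l k) (g : smor m l) (f : smor n m) :
  scomp h (scomp g f) = scomp (scomp h g) f.
Proof.
apply: semb_inj => y; rewrite !semb_comp.
have -> : semb (scomp g f) = fun z => fext (semb f) (semb g z).
  by apply/funext => z; rewrite semb_comp.
by rewrite -fext_fext.
Qed.

Definition S_category : category :=
  @Category nat smor sid scomp scomp1c scompc1 scompA.
End SCategory.

Section WideSubcategory.
Variables (C : category) (Q : forall A B : C, hom A B -> Prop).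
Hypothesis Q_id : forall A : C, Q (idc A).
Hypothesis Q_comp : forall (A B D : C) (g : hom B D) (f : hom A B),
  Q g -> Q f -> Q (comp g f).

Definition wide_hom (A B : C) : Type := {f : hom A B | Q f}.

Lemma wide_hom_ext (A B : C) (f g : wide_hom A B) : sval f = sval g -> f = g.
Proof.
case: f g => f hf [g hg] /= e; case: _ / e in hg *.
by congr exist; apply: Prop_irrelevance.
Qed.

Definition wide_id (A : C) : wide_hom A A := exist _ (idc A) (Q_id A).

Definition wide_comp (A B D : C) (g : wide_hom B D) (f : wide_hom A B) :
  wide_hom A D := exist _ (comp (sval g) (sval f)) (Q_comp (svalP g) (svalP f)).

Lemma wide_comp1c (A B : C) (f : wide_hom A B) : wide_comp (wide_id B) f = f.
Proof. by apply: wide_hom_ext; rewrite /= comp1c. Qed.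

Lemma wide_compc1 (A B : C) (f : wide_hom A B) : wide_comp f (wide_id A) = f.
Proof. by apply: wide_hom_ext; rewrite /= compc1. Qed.

Lemma wide_compA (A B D E : C) (h : wide_hom D E) (g : wide_hom B D)
    (f : wide_hom A B) :
  wide_comp h (wide_comp g f) = wide_comp (wide_comp h g) f.
Proof. by apply: wide_hom_ext; rewrite /= compA. Qed.

Definition wide_sub : category := Category wide_comp1c wide_compc1 wide_compA.
End WideSubcategory.

Definition surj n m (f : {ffun 'I_n -> 'I_m}) : bool :=
  [forall y, [exists x, f x == y]].

Lemma surjP n m (f : {ffun 'I_n -> 'I_m}) :
  reflect (forall y, exists x, f x = y) (surj f).
Proof.
apply: (iffP forallP) => h y.
  by have /existsP[x /eqP ex] := h y; exists x.
by apply/existsP; have [x <-] := h y; exists x.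
Qed.

Lemma surj_perm n (f : 'I_n -> 'I_n) : injective f -> surj (finfun f).
Proof.
move=> finj; apply/surjP => y.
by exists ((perm finj)^-1%g y); rewrite ffunE -[f _](permE finj) permKV.
Qed.

Lemma surj_comp n m l (g : {ffun 'I_m -> 'I_l}) (f : {ffun 'I_n -> 'I_m}) :
  surj g -> surj f -> surj [ffun x => g (f x)].
Proof.
move=> /surjP sg /surjP sf; apply/surjP => z.
by have [y <-] := sg z; have [x <-] := sf y; exists x; rewrite ffunE.
Qed.

Definition fin_id n : {ffun 'I_n -> 'I_n} := [ffun x => x].
Definition fin_comp n m l (g : {ffun 'I_m -> 'I_l}) (f : {ffun 'I_n -> 'I_m}) :
  {ffun 'I_n -> 'I_l} := [ffun x => g (f x)].

Lemma fin_comp1c n m (f : {ffun 'I_n -> 'I_m}) : fin_comp (fin_id m) f = f.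
Proof. by apply/ffunP => x; rewrite !ffunE. Qed.

Lemma fin_compc1 n m (f : {ffun 'I_n -> 'I_m}) : fin_comp f (fin_id n) = f.
Proof. by apply/ffunP => x; rewrite !ffunE. Qed.

Lemma fin_compA n m l k (h : {ffun 'I_l -> 'I_k}) (g : {ffun 'I_m -> 'I_l})
    (f : {ffun 'I_n -> 'I_m}) :
  fin_comp h (fin_comp g f) = fin_comp (fin_comp h g) f.
Proof. by apply/ffunP => x; rewrite !ffunE. Qed.

Definition fin_category : category :=
  @Category nat (fun n m => {ffun 'I_n -> 'I_m}) fin_id fin_comp
    fin_comp1c fin_compc1 fin_compA.

Definition Omega : category :=
  @wide_sub fin_category (fun n m f => surj f)
    (fun n => @surj_perm n id (fun _ _ e => e))
    (fun n m l g f => @surj_comp n m l g f).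

Section OmegaP.
Variables (P : operad) (U : unitary P).

Definition OmegaP : category :=
  @wide_sub (S_category U) (fun n m f => surj (sfun f))
    (fun n => @surj_perm n id (fun _ _ e => e))
    (fun n m l g f => @surj_comp n m l (sfun g) (sfun f)).

Definition is_pullback (A B C D : nat) (f : 'I_A -> 'I_B) (g : 'I_C -> 'I_D)
    (phi : 'I_A -> 'I_C) (psi : 'I_B -> 'I_D) : Prop :=
  (forall a, psi (f a) = g (phi a)) /\
  (forall b c, psi b = g c -> exists! a, f a = b /\ phi a = c).

Section FibrePush.
Variables (A B C D : nat) (f : 'I_A -> 'I_B) (g : 'I_C -> 'I_D).
Variables (phi : 'I_A -> 'I_C) (psi : 'I_B -> 'I_D).
Hypothesis pb : is_pullback f g phi psi.
Variable c : 'I_C.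

Lemma pullback_card_fib : #|fib phi c| = #|fib psi (g c)|.
Proof.
have [sq ex] := pb.
rewrite -(card_in_imset (f := f) (D := mem (fib phi c))) /=; last first.
  move=> a a'; rewrite !inE => /eqP ha /eqP ha' fa.
  have [|a0 [_ u]] := ex (f a) c; first by rewrite sq ha.
  by rewrite -(u a) ?fa // -(u a') // fa.
apply: eq_card => b; rewrite !inE; apply/imsetP/eqP => [[a]|/ex[a [[<- <-] _]]].
  by rewrite inE => /eqP ac ->; rewrite sq ac.
by exists a; rewrite // inE.
Qed.

(* The map g_* on operations induced by the bijection f from the fibre of phi
   over c to the fibre of psi over g c. *)
Definition fib_perm : 'S_#|fib psi (g c)| :=
  match_perm
    (fun k => f (fib_val phi c (cast_ord (esym pullback_card_fib) k)))
    (fib_val psi (g c)).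

Definition fib_push (P : operad) (w : P #|fib phi c|) : P #|fib psi (g c)| :=
  act (transport pullback_card_fib w) (fib_perm^-1)%g.

Lemma fib_permE k : fib_val psi (g c) (fib_perm k) =
  f (fib_val phi c (cast_ord (esym pullback_card_fib) k)).
Proof.
move: k; have [sq ex] := pb; apply: match_permE => [k k' e|k].
  apply: (@cast_ord_inj _ _ (esym pullback_card_fib)).
  apply: (@enum_val_inj _ (pred_of_set (fib phi c))).
  move: (cast_ord _ k) (cast_ord _ k') e => {}k {}k' e.
  have [|a0 [_ u]] := ex (f (fib_val phi c k)) c; first by rewrite sq fib_valP.
  by rewrite -(u _ (conj erefl (fib_valP k))) -(u _ (conj (esym e) (fib_valP k'))).
by apply: fib_rank; rewrite sq fib_valP.
Qed.
End FibrePush.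

Definition is_square (A B C D : nat) (f : @hom Omega A B) (g : @hom Omega C D)
    (phi : @hom OmegaP A C) (psi : @hom OmegaP B D) : Prop :=
  exists pb : is_pullback (sval f) (sval g) (sfun (sval phi)) (sfun (sval psi)),
    forall c : 'I_C, fib_push pb (sop (sval phi) c) = sop (sval psi) (sval g c).

Definition om_perm (n : nat) (s : 'S_n) : @hom Omega n n :=
  exist _ (finfun s) (surj_perm (@perm_inj _ s)).

Definition omP_perm (n : nat) (s : 'S_n) : @hom OmegaP n n :=
  exist _ (sinj U (@perm_inj _ s)) (surj_perm (@perm_inj _ s)).

Definition restr (A B : nat) (f : {ffun 'I_A -> 'I_B}) (A' : {set 'I_A}) :
    {ffun 'I_#|A'| -> 'I_B} :=
  [ffun k => f (enum_val k)].

Definition srestr (A C : nat) (phi : smor P A C) (A' : {set 'I_A}) :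
    smor P #|A'| C :=
  scomp phi (sinj U (@enum_val_inj _ (pred_of_set A'))).

Section Admissible.
Variables (A B C : nat) (f : @hom Omega A B) (phi : @hom OmegaP A C).

Definition admissible (A' : {set 'I_A}) : bool :=
  surj (restr (sval f) A') && surj (sfun (srestr (sval phi) A')).

Definition Adm : finType := {A' : {set 'I_A} | admissible A'}.

Definition om_restr (A' : Adm) : @hom Omega #|val A'| B :=
  exist _ (restr (sval f) (val A')) (proj1 (andP (valP A'))).

Definition omP_restr (A' : Adm) : @hom OmegaP #|val A'| C :=
  exist _ (srestr (sval phi) (val A')) (proj2 (andP (valP A'))).
End Admissible.

Record janus := Janus {
  job :> nat -> Ab;
  jcov : @functor_on Omega Ab job;
  jcontra : @functor_on (opposite OmegaP) Ab job }.

Definition jlow (M : janus) (n m : nat) (f : @hom Omega n m) :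
  hom (M n) (M m) := farr (jcov M) f.

Definition jup (M : janus) (n m : nat) (u : @hom OmegaP n m) :
  hom (M m) (M n) := @farr (opposite OmegaP) Ab M (jcontra M) m n u.

Record janus_hom (M N : janus) := JanusHom {
  jh :> forall n : nat, hom (M n) (N n);
  jh_low : forall (n m : nat) (f : @hom Omega n m),
      comp (jh m) (jlow M f) = comp (jlow N f) (jh n);
  jh_up : forall (n m : nat) (u : @hom OmegaP n m),
      comp (jh n) (jup M u) = comp (jup N u) (jh m) }.

Lemma janus_hom_ext (M N : janus) (s t : janus_hom M N) :
  (forall n, s n = t n) -> s = t.
Proof.
case: s t => [s s1 s2] [t t1 t2] /= e.
have {}e : s = t by apply: functional_extensionality_dep.
by case: _ / e in t1 t2 *; congr JanusHom; apply: Prop_irrelevance.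
Qed.

Lemma janus_id_low (M : janus) (n m : nat) (f : @hom Omega n m) :
  comp (idc (M m)) (jlow M f) = comp (jlow M f) (idc (M n)).
Proof. by rewrite comp1c compc1. Qed.

Lemma janus_id_up (M : janus) (n m : nat) (u : @hom OmegaP n m) :
  comp (idc (M n)) (jup M u) = comp (jup M u) (idc (M m)).
Proof. by rewrite comp1c compc1. Qed.

Definition janus_id (M : janus) : janus_hom M M :=
  JanusHom (@janus_id_low M) (@janus_id_up M).

Section JanusComp.
Variables (M N L : janus) (t : janus_hom N L) (s : janus_hom M N).

Lemma janus_comp_low (n m : nat) (f : @hom Omega n m) :
  comp (comp (t m) (s m)) (jlow M f) = comp (jlow L f) (comp (t n) (s n)).
Proof. by rewrite -compA jh_low compA jh_low compA. Qed.

Lemma janus_comp_up (n m : nat) (u : @hom OmegaP n m) :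
  comp (comp (t n) (s n)) (jup M u) = comp (jup L u) (comp (t m) (s m)).
Proof. by rewrite -compA jh_up compA jh_up compA. Qed.

Definition janus_comp : janus_hom M L := JanusHom janus_comp_low janus_comp_up.
End JanusComp.

Lemma janus_comp1c (M N : janus) (s : janus_hom M N) :
  janus_comp (janus_id N) s = s.
Proof. by apply: janus_hom_ext => n; apply: (comp1c (c := Ab)). Qed.

Lemma janus_compc1 (M N : janus) (s : janus_hom M N) :
  janus_comp s (janus_id M) = s.
Proof. by apply: janus_hom_ext => n; apply: (compc1 (c := Ab)). Qed.

Lemma janus_compA (M N L K : janus) (u : janus_hom L K) (t : janus_hom N L)
    (s : janus_hom M N) :
  janus_comp u (janus_comp t s) = janus_comp (janus_comp u t) s.
Proof. by apply: janus_hom_ext => n; apply: (compA (c := Ab)). Qed.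

Definition janus_category : category :=
  Category janus_comp1c janus_compc1 janus_compA.

Record pseudo_mackey (M : janus) : Prop := PseudoMackey {
  mackey_iso : forall (n : nat) (s : 'S_n),
      comp (jlow M (om_perm s)) (jup M (omP_perm s)) = idc (M n);
  mackey_square : forall (A B C D : nat)
      (f : @hom Omega A B) (g : @hom Omega C D)
      (phi : @hom OmegaP A C) (psi : @hom OmegaP B D),
      is_square f g phi psi -> forall x : M C,
      jup M psi (jlow M g x) =
      (\sum_(A' : Adm f phi) jlow M (om_restr A') (jup M (omP_restr A') x))%R }.

Definition pseudo_mackey_functors_le (n : nat) : category :=
  @full_sub janus_category
    {M : janus | pseudo_mackey M /\ is_trivial (M 0) /\
                 forall k, n < k -> is_trivial (M k)}
    (fun M => sval M).
End OmegaP.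

(* Main.v *)
Require Import Defs.
From HB Require Import structures.
From mathcomp Require Import all_boot all_order all_algebra all_fingroup.
From mathcomp Require Import generic_quotient boolp.
(* Some names of the operad definitions, such as [act1], also occur in the
   libraries of finite groups. *)
Import Defs.

(** A morphism of free algebras, being a tuple of words, is the same thing as a
    span of finite sets whose left leg is decorated by operations: label the
    positions of all the words by a set X, send each position to the word it
    lies in (this leg carries the operations) and to the letter it holds.  In
    the code the morphism is [comp (cov f) (con phi)], for a map f out of X and
    a decorated map phi out of X.  Such a span is unique up to a bijection of X
    ([span_uniq]), and the two legs commute through pullbacks
    ([free_pullback], [pullback_square]).

    From a functor F one gets a pseudo-Mackey functor by taking the cross
    effect cr F k, the elements of F(k) annihilated by every endomorphism that
    kills one generator.  A surjection f acts by F(cov f), which preserves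
    cross effects; a decorated surjection phi acts by F(con phi) followed by
    the projection of F(k) onto cr F k.  The pseudo-Mackey formula is what the
    decomposition of F(k) into the cross effects of the subsets of k
    ([cross_effect_decomposition]) gives when it is inserted in the middle of a
    pullback square: the subsets that are not admissible contribute zero.

    Conversely, let M be a pseudo-Mackey functor.  Were M = cr F, an element x
    of F(k) would be determined by the family y_a, where y_a is the projection
    of F(a) x to cr F d, for all morphisms a from k to d.  These families are
    characterised by two compatibilities: y_(con rho . a) = M^*(rho) y_a for
    decorated surjections rho, and, because F(a) x decomposes into cross effects
    over the subsets S of d,
      y_(cov g . a) = sum over S of M_*(g restricted to S) y_(r_S . a)
    where r_S retracts onto the generators in S, and M_* is taken to be zero on
    maps that are not onto.  The group [coh M k] of the families that satisfy
    them is taken as the value at k of a functor; a morphism b acts by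
    y |-> (a |-> y_(a . b)), which makes functoriality evident.

    The unit sends x to its family; it is bijective because both sides are
    determined by the components at the r_S ([proj_separates],
    [coh_separates]).  The counit sends y in the cross effect of coh M to its
    value at the identity.  It is injective because the purity of y makes the
    components at r_S vanish for proper S.  It is onto because an element m of
    M(k) extends to the family
      y_(cov f . con phi) = sum over S of M_*(f|S) M^*(phi|S) m,
    where S runs over the subsets of X and M^* too is extended by zero,
    and the compatibility of this family with decorated surjections is exactly
    the pseudo-Mackey formula ([extension_up]).

    The degree bounds match as well.  An injection into a sum of n+1 blocks
    either meets all of them, so that its source has more than n elements and
    M vanishes there, or misses one, so that the corresponding component
    factors through a retraction ([coh_polynomial]); conversely a generator can
    be chosen in each of n+1 nonempty blocks ([pure_blocks]). *)

Set Implicit Arguments.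
Unset Strict Implicit.
Unset Printing Implicit Defensive.

Import GRing.Theory.

Notation set_val S := (@enum_val _ (pred_of_set S)).
Notation set_sinj U S := (sinj U (@enum_val_inj _ (pred_of_set S))).

(** * The free category: words, generators and killing maps *)

Section FreeCalculus.
Variables (P : operad) (U : unitary P).

Notation FA n := (free_algebra P 'I_n).
Notation FC := (free_category P).

Definition no_letter (X : Type) (i : 'I_0) : X := False_rect _ (notF (ltn_ord i)).

(** The base point of an algebra, which every homomorphism preserves: the
    category of algebras is pointed because the operad is unitary. *)
Definition pt (A : algebra P) : A := mu (op0 U) (@no_letter A).

Lemma mu_op0 (A : algebra P) (x : 'I_0 -> A) : mu (op0 U) x = pt A.
Proof. by congr mu; apply/funext => -[]. Qed.

Lemma alg_hom_pt (A B : algebra P) (h : alg_hom A B) : h (pt A) = pt B.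
Proof. by rewrite afun_mu mu_op0. Qed.

Lemma cls_nil (X : Type) n (p : P n) (x : 'I_n -> X) :
  n = 0 -> cls p x = pt (free_algebra P X).
Proof.
move=> n0; case: _ / (esym n0) in p x *.
by rewrite (op0_uniq U p) cls_mu mu_op0.
Qed.

Lemma fextE (X : Type) (B : algebra P) (v : X -> B) n (p : P n) (x : 'I_n -> X) :
  fext v (cls p x) = mu p (fun i => v (x i)).
Proof. exact: fext_cls. Qed.

Lemma fext_relabel (X Y : Type) (v : X -> free_algebra P Y) (g : X -> Y)
  n (p : P n) (x : 'I_n -> X) : (forall i, v (x i) = eta P (g (x i))) ->
  fext v (cls p x) = cls p (fun i => g (x i)).
Proof.
by move=> e; rewrite fextE cls_mu; congr mu; apply/funext.
Qed.

(** Equality of words is a bijection of their positions under which letters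
    agree and which carries one operation to the other; the last clause says
    that it does so for every labelling of the positions, so that the
    operations can be compared independently of the letters. *)
Lemma cls_bij (X : Type) n n' (p : P n) (q : P n') (x : 'I_n -> X)
    (y : 'I_n' -> X) : cls p x = cls q y ->
  exists t : 'I_n -> 'I_n', [/\ bijective t, forall i, x i = y (t i) &
    forall (Y : Type) (z : 'I_n' -> Y), cls p (fun i => z (t i)) = cls q z].
Proof.
move=> e; have en := cls_arity e; case: _ / en in q y e *.
have [s [-> ey]] := (clsP _ _ _ _).1 e.
exists s; split=> [|i|Y z]; first by exists (s^-1)%g; [apply: permK|apply: permKV].
  by rewrite ey permK.
by rewrite cls_act; apply: cls_ext => i; rewrite permKV.
Qed.

(** Distinct letters leave no room for a permutation of the positions. *)
Lemma cls_injective n (X : Type) (p q : P n) (x : 'I_n -> X) :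
  injective x -> cls p x = cls q x -> p = q.
Proof.
move=> xi /clsP[s [-> ex]]; suff -> : s = 1%g by rewrite act1.
apply/permP => k; rewrite perm1; apply: xi.
by rewrite [LHS](congr1 (fun h => h (s k)) ex) permK.
Qed.

Definition fsub n m (w : 'I_n -> FA m) : @hom FC n m := fext (B := FA m) w.

Definition gen n m (a : @hom FC n m) (i : 'I_n) : FA m :=
  (a : alg_hom (FA n) (FA m)) (eta P i).

Lemma gen_fsub n m (w : 'I_n -> FA m) : gen (fsub w) =1 w.
Proof. exact: fext_eta. Qed.

Lemma gen_ext n m (a b : @hom FC n m) : gen a =1 gen b -> a = b.
Proof. exact: free_hom_ext. Qed.

Lemma gen_fsub_comp n m l (w : 'I_m -> FA l) (a : @hom FC n m) i :
  gen (comp (fsub w) a) i = fext w (gen a i).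
Proof. by []. Qed.

Lemma gen_comp n m l (b : @hom FC m l) (a : @hom FC n m) i :
  gen (comp b a) i = (b : alg_hom (FA m) (FA l)) (gen a i).
Proof. by []. Qed.

(** The two legs of a span: [cov] relabels letters and is covariant, [con]
    substitutes the decorated fibres of a map for the generators and is
    contravariant. *)
Definition cov n m (f : 'I_n -> 'I_m) : @hom FC n m :=
  fsub (fun i => eta P (f i)).

Definition con n m (phi : smor P n m) : @hom FC m n := fsub (semb phi).

Definition kill n (i : 'I_n) : @hom FC n n :=
  fsub (fun j => if j == i then pt (FA n) else eta P j).

Lemma cov_ext n m (f g : 'I_n -> 'I_m) : f =1 g -> cov f = cov g.
Proof. by move=> /funext ->. Qed.

Lemma cov_id n : cov (fun i : 'I_n => i) = idc (n : FC).
Proof. by apply: gen_ext => i; rewrite gen_fsub. Qed.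

Lemma cov_id_ext n (f : 'I_n -> 'I_n) :
  (forall i, f i = i) -> cov f = idc (n : FC).
Proof. by move=> e; rewrite -cov_id; apply: cov_ext. Qed.

Lemma cov_comp n m l (g : 'I_m -> 'I_l) (f : 'I_n -> 'I_m) :
  cov (fun i => g (f i)) = comp (cov g) (cov f).
Proof. by apply: gen_ext => i; rewrite gen_fsub_comp !gen_fsub fext_eta. Qed.

Lemma con_comp n m l (g : smor P m l) (f : smor P n m) :
  con (scomp g f) = comp (con f) (con g).
Proof. by apply: gen_ext => i; rewrite gen_fsub_comp !gen_fsub semb_comp. Qed.

Lemma con_id n : con (sid U n) = idc (n : FC).
Proof. by apply: gen_ext => i; rewrite gen_fsub semb_id. Qed.

Lemma semb_nil n m (phi : smor P n m) y :
  (forall x, phi x <> y) -> semb phi y = pt (FA n).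
Proof.
move=> h; apply: cls_nil; apply/eqP; rewrite cards_eq0; apply/eqP/setP => x.
by rewrite !inE; apply/eqP.
Qed.

Lemma semb_sinj n m (i : 'I_n -> 'I_m) (ii : injective i) x :
  semb (sinj U ii) (i x) = eta P x.
Proof.
have [k ek] : exists k, fib_val (sinj U ii) (i x) k = x.
  by apply: fib_rank; rewrite /= ffunE.
exact: cls_inj_op ek.
Qed.

Lemma semb_sinj_nil n m (i : 'I_n -> 'I_m) (ii : injective i) y :
  (forall x, i x <> y) -> semb (sinj U ii) y = pt (FA n).
Proof. by move=> h; apply: semb_nil => x; rewrite /= ffunE. Qed.

Lemma sinj_irr n m (i j : 'I_n -> 'I_m) (ii : injective i) (jj : injective j) :
  i =1 j -> sinj U ii = sinj U jj.
Proof.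
by move=> /funext e; case: _ / e in jj *; congr sinj; apply: Prop_irrelevance.
Qed.

Lemma con_sinj_cov n m (i : 'I_n -> 'I_m) (ii : injective i) :
  comp (con (sinj U ii)) (cov i) = idc (n : FC).
Proof.
by apply: gen_ext => x; rewrite gen_fsub_comp gen_fsub fext_eta semb_sinj.
Qed.

Lemma sinj_comp n m l (j : 'I_m -> 'I_l) (i : 'I_n -> 'I_m)
    (jj : injective j) (ii : injective i)
    (ji : injective (fun x => j (i x))) :
  sinj U ji = scomp (sinj U jj) (sinj U ii).
Proof.
apply: semb_inj => y; rewrite semb_comp.
case: (pselect (exists x, j x = y)) => [[x <-]|ny].
  rewrite semb_sinj fext_eta.
  case: (pselect (exists z, i z = x)) => [[z <-]|nx].
    by rewrite semb_sinj (semb_sinj ji).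
  rewrite !semb_sinj_nil // => z; first by move=> e; apply: nx; exists z.
  by move=> /jj e; apply: nx; exists z.
rewrite (semb_sinj_nil jj) ?alg_hom_pt; last by move=> x e; apply: ny; exists x.
by rewrite semb_sinj_nil // => x e; apply: ny; exists (i x).
Qed.

Lemma kill_self n (i : 'I_n) : gen (kill i) i = pt (FA n).
Proof. by rewrite gen_fsub eqxx. Qed.

Lemma kill_other n (i j : 'I_n) : j != i -> gen (kill i) j = eta P j.
Proof. by rewrite gen_fsub => /negPf ->. Qed.

(** The form in which a morphism is shown to vanish on cross effects: it kills
    a generator as soon as it absorbs [kill i] on the right.  Dually, absorbing
    [kill i] on the left says that the letter i does not occur in its values,
    so that it dies under the projection onto the cross effect. *)
Lemma kill_fixes n m (i : 'I_n) (a : @hom FC n m) :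
  gen a i = pt (FA m) -> comp a (kill i) = a.
Proof.
move=> e; apply: gen_ext => j; rewrite gen_comp.
have [->|ji] := eqVneq j i; first by rewrite kill_self alg_hom_pt e.
by rewrite kill_other.
Qed.

Lemma kill_idem n (i : 'I_n) : comp (kill i) (kill i) = kill i.
Proof. by rewrite kill_fixes ?kill_self. Qed.

Lemma kill_comm n (i j : 'I_n) :
  comp (kill i) (kill j) = comp (kill j) (kill i).
Proof.
have [->//|ij] := eqVneq i j.
apply: gen_ext => k; rewrite !gen_comp.
have [->|ki] := eqVneq k i.
  by rewrite kill_self (kill_other ij) alg_hom_pt; apply: kill_self.
have kj0 : j != i by rewrite eq_sym.
have [->|kj] := eqVneq k j.
  by rewrite kill_self alg_hom_pt (kill_other kj0); apply/esym/kill_self.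
rewrite (kill_other ki) (kill_other kj).
exact: etrans (kill_other ki) (esym (kill_other kj)).
Qed.

(** Relabelling by an onto map preserves cross effects: killing the letter
    f i after relabelling kills the generator i before. *)
Lemma kill_cov n m (f : 'I_n -> 'I_m) i :
  comp (comp (kill (f i)) (cov f)) (kill i) = comp (kill (f i)) (cov f).
Proof.
by apply: kill_fixes; rewrite gen_comp gen_fsub; apply: kill_self.
Qed.

Lemma kill_cov_miss n m (f : 'I_n -> 'I_m) y :
  (forall x, f x <> y) -> comp (kill y) (cov f) = cov f.
Proof.
move=> h; apply: gen_ext => x; rewrite gen_fsub_comp !gen_fsub fext_eta.
by case: eqP => // /h.
Qed.

Lemma con_kill_miss n m (phi : smor P n m) y :
  (forall x, phi x <> y) -> comp (con phi) (kill y) = con phi.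
Proof. by move=> h; apply: kill_fixes; rewrite gen_fsub semb_nil. Qed.

(** Killing the generator phi x removes the whole fibre of phi through x from
    the values of [con phi], hence the letter x.  For phi onto, this makes the
    projection of F(con phi) depend only on the cross effect component. *)
Lemma kill_con n m (phi : smor P n m) x :
  comp (kill x) (comp (con phi) (kill (phi x))) =
  comp (con phi) (kill (phi x)).
Proof.
apply: gen_ext => y; rewrite gen_comp.
have [->|yx] := eqVneq y (phi x).
  by rewrite gen_comp kill_self !alg_hom_pt.
rewrite gen_fsub_comp kill_other // fext_eta.
rewrite (fext_relabel (v := fun j => if j == x then _ else _) (g := id)) //.
move=> k; case: eqP => // e; case/eqP: yx.
by rewrite -e fib_valP.
Qed.

End FreeCalculus.

(** * Morphisms of free algebras as spans *)

Section SpanCalculus.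
Variables (P : operad) (U : unitary P).
Notation FA n := (free_algebra P 'I_n).
Notation FC := (free_category P).

(** A word whose letters are distinct can be rewritten with its letters in
    increasing order, which is the normal form of the decorations of [smor]. *)
Lemma word_on_set n (A : {set 'I_n}) m (p : P m) (x : 'I_m -> 'I_n) :
  injective x -> (forall i, i \in A <-> exists l, x l = i) ->
  exists q : P #|A|, cls q (set_val A) = cls p x.
Proof.
move=> xi xA; have em : m = #|A|.
  rewrite -(card_ord m) -(card_imset _ xi); apply: eq_card => i.
  apply/imsetP/idP => [[l _ ->]|/xA[l <-]]; last by exists l.
  by apply/xA; exists l.
move: A em xA => A em; case: _ / (esym em) in p x xi * => xA.
have H k : exists l, set_val A l = x k.
  have xk : x k \in A by apply/xA; exists k.
  by exists (enum_rank_in xk (x k)); rewrite enum_rankK_in.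
exists (act p ((match_perm x (set_val A))^-1)%g).
by rewrite cls_act; apply: cls_ext => i; rewrite invgK match_permE.
Qed.

(** Decorated maps from unordered data: the operations may be given on any
    enumeration of the fibres, and the casts and reordering permutations that
    [sop] requires are confined to this construction. *)
Lemma smor_of_words n t (r : 'I_n -> 'I_t) (w : 'I_t -> FA n) :
  (forall j, exists m (p : P m) (x : 'I_m -> 'I_n),
     [/\ w j = cls p x, injective x & forall i, r i = j <-> exists l, x l = i]) ->
  exists rho : smor P n t, sfun rho =1 r /\ forall j, semb rho j = w j.
Proof.
move=> H; pose f := finfun r.
have {}H j : exists q : P #|fib f j|, cls q (fib_val f j) = w j.
  have [m [p [x [-> xi xr]]]] := H j; apply: word_on_set => // i.
  by rewrite inE ffunE -xr; split=> /eqP.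
exists (@SMor P n t f (fun j => projT1 (cid (H j)))); split=> [i|j].
  by rewrite /= ffunE.
exact: (projT2 (cid (H j))).
Qed.

(** A decorated map factors through any subset that contains its image, since
    the fibres outside the image are empty and P(0) is a point. *)
Lemma smor_factor n t k (phi : smor P n k) (i : 'I_t -> 'I_k)
    (ii : injective i) (r : 'I_n -> 'I_t) : (forall x, i (r x) = phi x) ->
  exists rho : smor P n t, sfun rho =1 r /\ scomp (sinj U ii) rho = phi.
Proof.
move=> ir.
have [j|rho [rr wr]] := @smor_of_words n t r (fun j => semb phi (i j)).
  exists _, (sop phi (i j)), (fib_val phi (i j)).
  split=> // [|x]; first exact: enum_val_inj.
  split=> [<-|[l <-]]; last by apply: ii; rewrite ir fib_valP.
  by apply: fib_rank; rewrite ir.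
exists rho; split=> //; apply: semb_inj => y; rewrite semb_comp.
case: (pselect (exists x, i x = y)) => [[x <-]|ny].
  by rewrite semb_sinj fext_eta wr.
rewrite semb_sinj_nil ?(alg_hom_pt U); last by move=> x e; apply: ny; exists x.
by rewrite (semb_nil U) // => x e; apply: ny; exists (r x); rewrite ir.
Qed.

(** The apex of the span is the set of positions in the words a(1), ..., a(k),
    that is, the ordinal sum of their lengths. *)
Lemma free_span k d (a : @hom FC k d) :
  exists X (phi : smor P X k) (f : 'I_X -> 'I_d), a = comp (cov P f) (con phi).
Proof.
pose w i := gen a i; pose m i := war (w i).
have [j|phi [_ wphi]] := @smor_of_words (\sum_i m i) k (fun l => blk l)
    (fun j => cls (wop (w j)) (@tagnat.Rank _ m j)).
  exists _, (wop (w j)), (@tagnat.Rank _ m j); split=> // [t u /(congr1 val)/eqP|i].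
    by rewrite tagnat.eq_Rank => /andP[_ /eqP/val_inj].
  split=> [ji|[l <-]]; last exact: (Rank_eq erefl).1.
  by case: _ / ji; exists (pos i); rewrite tagnat.sig2K.
exists _, phi, (concat (fun i => @wlet _ _ (w i))).
apply: gen_ext => i; rewrite gen_fsub_comp gen_fsub wphi.
rewrite (fext_relabel (g := concat (fun i => @wlet _ _ (w i)))) //.
rewrite -[LHS]wrepK; apply: cls_ext => t.
by rewrite concat_Rank.
Qed.

Lemma gen_span k d X (phi : smor P X k) (f : 'I_X -> 'I_d) y :
  gen (comp (cov P f) (con phi)) y =
  cls (sop phi y) (fun t => f (fib_val phi y t)).
Proof. by rewrite gen_fsub_comp gen_fsub; apply: fext_relabel. Qed.

(** The values of both spans at a generator y are words on the fibres over y;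
    their equality yields a bijection of the fibres, and these bijections are
    glued to s. *)
Lemma span_uniq k d X X' (phi : smor P X k) (f : 'I_X -> 'I_d)
    (phi' : smor P X' k) (f' : 'I_X' -> 'I_d) :
  comp (cov P f) (con phi) = comp (cov P f') (con phi') ->
  exists (s : 'I_X' -> 'I_X) (si : injective s),
    [/\ forall x, exists x', s x' = x, f' =1 (fun x => f (s x)) &
        phi' = scomp phi (sinj U si)].
Proof.
move=> e.
have B y := cid (cls_bij (etrans (esym (gen_span phi' f' y))
  (etrans (congr1 (fun a => gen a y) (esym e)) (gen_span phi f y)))).
pose t y := projT1 (B y).
have ht y : [/\ bijective (t y),
    forall k', f' (fib_val phi' y k') = f (fib_val phi y (t y k')) &
    forall (Y : Type) (z : _ -> Y),
      cls (sop phi' y) (fun i => z (t y i)) = cls (sop phi y) z].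
  exact: (projT2 (B y)).
have [x'|s hs] := @choice _ _ (fun x' x => exists y k',
    fib_val phi' y k' = x' /\ x = fib_val phi y (t y k')).
  have [k' ek] := fib_rank (erefl (phi' x')).
  by exists (fib_val phi (phi' x') (t (phi' x') k')), (phi' x'), k'.
have {}hs y k' : s (fib_val phi' y k') = fib_val phi y (t y k').
  have [y0 [k0 [e1 ->]]] := hs (fib_val phi' y k').
  have ey : y0 = y by rewrite -(fib_valP k0) e1 fib_valP.
  by case: _ / (esym ey) in k0 e1 *; rewrite (enum_val_inj e1).
have si : injective s.
  move=> x1 x2.
  have [k1 <-] := fib_rank (erefl (phi' x1)).
  have [k2 <-] := fib_rank (erefl (phi' x2)).
  move: (phi' x1) (phi' x2) k1 k2 => y y' k1 k2; rewrite !hs => es.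
  have ey : y' = y by rewrite -(fib_valP (t y' k2)) -es fib_valP.
  case: _ / (esym ey) in k2 es *.
  by have [/bij_inj ti _ _] := ht y; rewrite (ti _ _ (enum_val_inj es)).
exists s, si; split=> [x|x'|].
- have [l <-] := fib_rank (erefl (phi x)); have [[t' _ tK] _ _] := ht (phi x).
  by exists (fib_val phi' (phi x) (t' l)); rewrite hs tK.
- have [l <-] := fib_rank (erefl (phi' x')).
  by rewrite hs; have [_ -> _] := ht (phi' x').
apply: semb_inj => y; rewrite semb_comp /semb.
have [_ _ <-] := ht y.
have -> : (fun i => fib_val phi y (t y i)) = (fun i => s (fib_val phi' y i)).
  by apply/funext => i; rewrite hs.
rewrite fextE [LHS]cls_mu; congr mu; apply/funext => i.
exact/esym/semb_sinj.
Qed.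

(** The apex is the set of pairs (x, e) with f x = rho e; over x it is in
    bijection with the fibre of rho over f x, from which it takes its
    operation. *)
Lemma free_pullback X d d' (f : 'I_X -> 'I_d) (rho : smor P d' d) :
  exists Q (h : 'I_Q -> 'I_d') (theta : smor P Q X),
    is_pullback h f theta rho /\
    comp (con rho) (cov P f) = comp (cov P h) (con theta).
Proof.
pose A : {set 'I_X * 'I_d'} := [set xe | f xe.1 == rho xe.2].
pose v : 'I_#|A| -> 'I_X * 'I_d' := @enum_val _ (pred_of_set A).
have vi : injective v by exact: enum_val_inj.
have rk x e : f x = rho e -> exists q, v q = (x, e).
  move=> fx; have xA : (x, e) \in A by rewrite inE fx /=.
  by exists (enum_rank_in xA (x, e)); rewrite /v enum_rankK_in.
have vP q : f (v q).1 = rho (v q).2 by have := enum_valP q; rewrite inE => /eqP.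
have R x t : exists q, v q = (x, fib_val rho (f x) t).
  by apply: rk; rewrite fib_valP.
pose w x t := projT1 (cid (R x t)).
have wP x t : v (w x t) = (x, fib_val rho (f x) t).
  exact: (projT2 (cid (R x t))).
have [x|theta [th1 th2]] := @smor_of_words #|A| X (fun q => (v q).1)
    (fun x => cls (sop rho (f x)) (w x)).
  exists _, (sop rho (f x)), (w x); split=> // [t u /(congr1 v)|q].
    by rewrite !wP => -[/enum_val_inj].
  split=> [<-|[t <-]]; last by rewrite wP.
  have [t et] := fib_rank (esym (vP q)); exists t; apply: vi.
  by rewrite wP et -surjective_pairing.
exists _, (fun q => (v q).2), theta; split; first split=> [q|e x ex].
- by rewrite th1 vP.
- have [q vq] := rk x e (esym ex); exists q; split; first by rewrite th1 vq.
  by move=> q' [e1 e2]; apply: vi; rewrite vq (surjective_pairing (v q')) -th1 e1 e2.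
apply: gen_ext => x; rewrite !gen_fsub_comp !gen_fsub fext_eta th2.
rewrite (fext_relabel (g := fun q => (v q).2)) //.
by apply: cls_ext => t; rewrite wP.
Qed.

Lemma cls_fib_push A B C D (f : 'I_A -> 'I_B) (g : 'I_C -> 'I_D)
    (phi : 'I_A -> 'I_C) (psi : 'I_B -> 'I_D) (pb : is_pullback f g phi psi)
    c (w : P #|fib phi c|) :
  cls (fib_push pb w) (fib_val psi (g c)) = cls w (fun t => f (fib_val phi c t)).
Proof.
rewrite /fib_push cls_act cls_transport; apply: cls_ext => t.
by rewrite invgK fib_permE cast_ordK.
Qed.

(** Squares of the double category are the pullback squares that commute as
    morphisms of free algebras.  In the nontrivial direction the operations
    are recovered from the words by [cls_injective]. *)
Lemma pullback_square A B C D (f : 'I_A -> 'I_B) (g : 'I_C -> 'I_D)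
    (phi : smor P A C) (psi : smor P B D) (pb : is_pullback f g phi psi) :
  (forall c, fib_push pb (sop phi c) = sop psi (g c)) <->
  comp (con psi) (cov P g) = comp (cov P f) (con phi).
Proof.
have E c : gen (comp (con psi) (cov P g)) c = semb psi (g c).
  by rewrite gen_fsub_comp gen_fsub fext_eta.
split=> [e|e c].
  by apply: gen_ext => c; rewrite E gen_span -(cls_fib_push pb) e.
apply: (@cls_injective _ _ _ _ _ (fib_val psi (g c))); first exact: enum_val_inj.
by rewrite cls_fib_push -gen_span -e E.
Qed.
End SpanCalculus.

(** * Subgroups, products and natural isomorphisms *)

Section AdditiveMaps.
Local Open Scope ring_scope.

Definition add_map (A B : zmodType) (f : A -> B)
    (hf : forall x y, f (x - y) = f x - f y) : {additive A -> B} :=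
  let m := GRing.isZmodMorphism.Build A B f hf in
  HB.pack_for {additive A -> B} f m.

Lemma additive_inverse (A B : Ab) (f : hom A B) : bijective f ->
  exists g : hom B A, comp g f = idc A /\ comp f g = idc B.
Proof.
case=> g fK gK.
have hg x y : g (x - y) = g x - g y.
  by apply: (can_inj fK); rewrite gK raddfB !gK.
by exists (add_map hg); split; apply: additive_ext.
Qed.

Lemma additive_bij (A B : zmodType) (f : {additive A -> B}) :
  (forall x, f x = 0 -> x = 0) -> (forall y, exists x, f x = y) -> bijective f.
Proof.
move=> fi fs; pose g y := projT1 (cid (fs y)).
have gK y : f (g y) = y := projT2 (cid (fs y)).
exists g => // x; apply/eqP; rewrite -subr_eq0; apply/eqP/fi.
by rewrite raddfB gK subrr.
Qed.
End AdditiveMaps.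

Section Subgroup.
Local Open Scope ring_scope.
Variables (V : zmodType) (Q : V -> Prop).

Definition sub_closed := Q 0 /\ forall x y, Q x -> Q y -> Q (x - y).

Definition subgroup of sub_closed : Type := {x : V | Q x}.

Variable H : sub_closed.
Notation S := (subgroup H).

HB.instance Definition _ := gen_eqMixin S.
HB.instance Definition _ := gen_choiceMixin S.

Lemma subgroup_ext (x y : S) : sval x = sval y -> x = y.
Proof. by case: x y => x hx [y hy] /= e; apply: eq_exist. Qed.

Lemma subgroup_opp x : Q x -> Q (- x).
Proof. by move=> hx; rewrite -sub0r; apply: H.2 => //; apply: H.1. Qed.

Lemma subgroup_add x y : Q x -> Q y -> Q (x + y).
Proof. by move=> hx hy; rewrite -[y]opprK; apply: H.2 => //; apply: subgroup_opp. Qed.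

Definition sg0 : S := exist _ 0 H.1.
Definition sgN (x : S) : S := exist _ (- sval x) (subgroup_opp (svalP x)).
Definition sgD (x y : S) : S :=
  exist _ (sval x + sval y) (subgroup_add (svalP x) (svalP y)).

Lemma sgA : associative sgD.
Proof. by move=> x y z; apply: subgroup_ext; apply: addrA. Qed.
Lemma sgC : commutative sgD.
Proof. by move=> x y; apply: subgroup_ext; apply: addrC. Qed.
Lemma sg0D : left_id sg0 sgD.
Proof. by move=> x; apply: subgroup_ext; apply: add0r. Qed.
Lemma sgND : left_inverse sg0 sgN sgD.
Proof. by move=> x; apply: subgroup_ext; apply: addNr. Qed.

HB.instance Definition _ := GRing.isZmodule.Build S sgA sgC sg0D sgND.

Lemma sg_valB (x y : S) : sval (x - y) = sval x - sval y.
Proof. by []. Qed.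

Definition sg_val : {additive S -> V} := add_map sg_valB.

Section Corestriction.
Variables (W : zmodType) (f : {additive W -> V}) (fQ : forall x, Q (f x)).

Definition corestr_fun (x : W) : S := exist _ (f x) (fQ x).

Lemma corestrB x y : corestr_fun (x - y) = corestr_fun x - corestr_fun y.
Proof. by apply: subgroup_ext; rewrite /= raddfB. Qed.

Definition corestr : {additive W -> S} := add_map corestrB.
End Corestriction.
End Subgroup.

Section Product.
Local Open Scope ring_scope.
Variables (I : Type) (V : I -> zmodType).

Definition big_prod : Type := forall i, V i.

HB.instance Definition _ := gen_eqMixin big_prod.
HB.instance Definition _ := gen_choiceMixin big_prod.

Lemma big_prod_ext (x y : big_prod) : (forall i, x i = y i) -> x = y.
Proof. exact: functional_extensionality_dep. Qed.

Definition bp0 : big_prod := fun i => 0.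
Definition bpN (x : big_prod) : big_prod := fun i => - x i.
Definition bpD (x y : big_prod) : big_prod := fun i => x i + y i.
Lemma bpA : associative bpD.
Proof. by move=> x y z; apply: big_prod_ext => i; apply: addrA. Qed.
Lemma bpC : commutative bpD.
Proof. by move=> x y; apply: big_prod_ext => i; apply: addrC. Qed.
Lemma bp0D : left_id bp0 bpD.
Proof. by move=> x; apply: big_prod_ext => i; apply: add0r. Qed.
Lemma bpND : left_inverse bp0 bpN bpD.
Proof. by move=> x; apply: big_prod_ext => i; apply: addNr. Qed.

HB.instance Definition _ := GRing.isZmodule.Build big_prod bpA bpC bp0D bpND.

End Product.

Section NatIso.
Lemma nat_iso (C D : category) (F G : functor C D) (s : nat_trans F G) :
  (forall A, exists t : hom (G A) (F A),
     comp t (s A) = idc (F A) /\ comp (s A) t = idc (G A)) ->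
  exists t : nat_trans G F, nt_comp t s = nt_id F /\ nt_comp s t = nt_id G.
Proof.
move=> H; pose t A := projT1 (cid (H A)).
have tP A : comp (t A) (s A) = idc (F A) /\ comp (s A) (t A) = idc (G A).
  exact: (projT2 (cid (H A))).
have tn (A B : C) (f : hom A B) :
    comp (t B) (fmap G f) = comp (fmap F f) (t A).
  rewrite -[LHS]compc1 -(tP A).2 -compA [X in comp _ X]compA -nt_natural.
  by rewrite !compA (tP B).1 comp1c.
by exists (NatTrans tn); split; apply: nat_trans_ext => A; have [] := tP A.
Qed.

Lemma nat_iso_ab (C : category) (F G : functor C Ab) (s : nat_trans F G) :
  (forall A, bijective (s A)) ->
  exists t : nat_trans G F, nt_comp t s = nt_id F /\ nt_comp s t = nt_id G.
Proof. by move=> H; apply: nat_iso => A; apply: additive_inverse. Qed.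

Lemma janus_iso (P : operad) (U : unitary P) (M N : janus U)
    (s : janus_hom M N) :
  (forall n, bijective (s n)) ->
  exists t : janus_hom N M,
    janus_comp t s = janus_id M /\ janus_comp s t = janus_id N.
Proof.
move=> H; pose t n := projT1 (cid (additive_inverse (H n))).
have tP n : comp (t n) (s n) = idc (M n) /\ comp (s n) (t n) = idc (N n).
  exact: (projT2 (cid (additive_inverse (H n)))).
have sw n m (a : hom (M n) (M m)) (b : hom (N n) (N m)) :
    comp (s m) a = comp b (s n) -> comp (t m) b = comp a (t n).
  move=> e; rewrite -[LHS](compc1 (c := Ab)) -(tP n).2 -compA.
  by rewrite [X in comp _ X]compA -e !compA (tP m).1 comp1c.
have tl n m (f : @hom Omega n m) :
    comp (t m) (jlow N f) = comp (jlow M f) (t n).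
  by apply: sw; apply: jh_low.
have tu n m (u : @hom (OmegaP U) n m) :
    comp (t n) (jup N u) = comp (jup M u) (t m).
  by apply: sw; apply: jh_up.
by exists (JanusHom tl tu); split; apply: janus_hom_ext => n; have [] := tP n.
Qed.
End NatIso.

(** * The projection onto the cross effect *)

Lemma set_val_rank n (S : {set 'I_n}) x : x \in S -> exists k, set_val S k = x.
Proof. by move=> xS; exists (enum_rank_in xS x); rewrite enum_rankK_in. Qed.

Section MoreKill.
Variables (P : operad) (U : unitary P).

(** Killing a generator is a retraction onto the other ones followed by their
    inclusion: this allows induction on the number of generators. *)
Lemma kill_factor n (i : 'I_n.+1) :
  kill U i = comp (cov P (lift i)) (con (sinj U (@lift_inj _ i))).
Proof.
apply: gen_ext => j; rewrite gen_fsub_comp gen_fsub [in RHS]gen_fsub.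
have [->|ji] := eqVneq j i.
  rewrite semb_sinj_nil ?alg_hom_pt // => x e.
  by case/eqP: (neq_lift i x); rewrite e.
case: (unliftP i j) ji => [j' ->|->] ji; last by rewrite eqxx in ji.
by rewrite semb_sinj fext_eta.
Qed.

Lemma con_sinj_cov_miss n m k (i : 'I_n -> 'I_k) (ii : injective i)
    (j : 'I_m -> 'I_k) t : (forall s, j s <> i t) ->
  comp (kill U t) (comp (con (sinj U ii)) (cov P j)) =
  comp (con (sinj U ii)) (cov P j).
Proof.
move=> h; apply: gen_ext => s; rewrite gen_comp gen_fsub_comp gen_fsub fext_eta.
case: (pselect (exists x, i x = j s)) => [[x e]|n0].
  rewrite -e semb_sinj; apply: kill_other.
  by apply/eqP => xt; apply: (h s); rewrite -e xt.
by rewrite semb_sinj_nil ?alg_hom_pt // => x e; apply: n0; exists x.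
Qed.

Lemma con_sinj_cov_kill n m k (i : 'I_n -> 'I_k) (ii : injective i)
    (j : 'I_m -> 'I_k) s : (forall t, i t <> j s) ->
  comp (comp (con (sinj U ii)) (cov P j)) (kill U s) =
  comp (con (sinj U ii)) (cov P j).
Proof.
move=> h; apply: kill_fixes.
by rewrite gen_fsub_comp gen_fsub fext_eta semb_sinj_nil.
Qed.
End MoreKill.

Section CrossEffectFunctor.
Local Open Scope ring_scope.
Variables (P : operad) (U : unitary P).
Notation FC := (free_category P).

Section OneFunctor.
Variable F : functor FC Ab.

Notation "F[ a ]" := (fmap F a) (at level 0, format "F[ a ]").

Lemma fmapM n m l (b : @hom FC m l) (a : @hom FC n m) (x : F n) :
  F[comp b a] x = F[b] (F[a] x).
Proof. by rewrite /fmap farr_comp. Qed.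

Lemma fmap1 n (x : F n) : F[idc (n : FC)] x = x.
Proof. by rewrite /fmap farr_id. Qed.

(** The cross effect of F evaluated on the generators: in the notation of
    cross effects, x lies in cr_n F(1, ..., 1). *)
Definition pure n (x : F n) : Prop := forall i : 'I_n, F[kill U i] x = 0.

Lemma pure_closed n : sub_closed (@pure n).
Proof.
split=> [i|x y hx hy i]; first exact: raddf0.
by rewrite raddfB hx hy subr0.
Qed.

(** The composite over i in s of the commuting idempotents 1 - F(kill i). *)
Definition proj_seq n (s : seq 'I_n) (x : F n) : F n :=
  foldr (fun i y => y - F[kill U i] y) x s.

Definition proj n (x : F n) : F n := proj_seq (enum 'I_n) x.

Lemma projB n (x y : F n) : proj (x - y) = proj x - proj y.
Proof.
rewrite /proj; elim: (enum _) => //= i s ->.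
by rewrite raddfB !opprD !opprK addrACA.
Qed.

Definition projA n : {additive F n -> F n} := add_map (@projB n).

Lemma proj0 n : proj (0 : F n) = 0.
Proof. exact: (raddf0 (@projA n)). Qed.

Lemma kill_proj_seq n (s : seq 'I_n) i (x : F n) :
  F[kill U i] (proj_seq s x) = proj_seq s (F[kill U i] x).
Proof.
elim: s => //= j s IH.
by rewrite raddfB IH -fmapM kill_comm fmapM IH.
Qed.

Lemma proj_kill n i (x : F n) : proj (F[kill U i] x) = 0.
Proof.
have: i \in enum 'I_n by rewrite mem_enum.
rewrite /proj; elim: (enum _) => //= j s IH.
rewrite inE => /orP[/eqP <-|/IH ->]; last by rewrite raddf0 subr0.
by rewrite -kill_proj_seq -fmapM kill_idem subrr.
Qed.

Lemma pure_proj n (x : F n) : pure (proj x).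
Proof. by move=> i; rewrite [LHS]kill_proj_seq; apply: proj_kill. Qed.

Lemma proj_pure n (x : F n) : pure x -> proj x = x.
Proof.
move=> hx; rewrite /proj; elim: (enum _) => //= i s ->.
by rewrite hx subr0.
Qed.

Lemma proj_miss n m (i : 'I_m) (a : @hom FC n m) x :
  comp (kill U i) a = a -> proj (F[a] x) = 0.
Proof. by move=> <-; rewrite fmapM proj_kill. Qed.

Lemma pure_kill n m (i : 'I_n) (a : @hom FC n m) x :
  pure x -> comp a (kill U i) = a -> F[a] x = 0.
Proof. by move=> hx <-; rewrite fmapM hx raddf0. Qed.

(** The projection differs from the identity by images of the F(kill i). *)
Lemma proj_absorb n (W : zmodType) (L : {additive F n -> W}) x :
  (forall i y, L (F[kill U i] y) = 0) -> L (proj x) = L x.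
Proof.
move=> h; rewrite /proj; elim: (enum _) => //= i s <-.
by rewrite raddfB h subr0.
Qed.

Lemma pure_cov n m (f : 'I_n -> 'I_m) x :
  (forall y, exists x, f x = y) -> pure x -> pure (F[cov P f] x).
Proof.
move=> fs hx i; have [j <-] := fs i.
by rewrite -fmapM; apply: (pure_kill (i := j)) => //; rewrite kill_cov.
Qed.

(** This is the functoriality of the contravariant part of the cross effect:
    projecting at an intermediate stage changes nothing. *)
Lemma proj_con_proj n m (phi : smor P n m) x :
  (forall y, exists x, phi x = y) ->
  proj (F[con phi] (proj x)) = proj (F[con phi] x).
Proof.
move=> ps; apply: (@proj_absorb _ _ (@projA n \o F[con phi])) => i y.
have [j <-] := ps i; rewrite /= -fmapM.
by apply: (proj_miss (i := j)); rewrite kill_con.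
Qed.

(** By induction on k, all the F(kill i) z vanish, because they factor through
    k - 1 generators; hence z lies in the cross effect and is its own
    projection, which is the component at the identity. *)
Lemma proj_separates_inj k (z : F k) :
  (forall e (i : 'I_e -> 'I_k) (ii : injective i),
     proj (F[con (sinj U ii)] z) = 0) -> z = 0.
Proof.
elim: k z => [|k IH] z h.
  rewrite -(proj_pure (x := z)); last by case.
  by have := h _ id (fun _ _ e => e); rewrite [con _]con_id fmap1.
rewrite -(proj_pure (x := z)).
  by have := h _ id (fun _ _ e => e); rewrite [con _]con_id fmap1.
move=> i; rewrite kill_factor fmapM (IH (F[con (sinj U (@lift_inj _ i))] z)) ?raddf0 //.
move=> e j jj; rewrite -fmapM -con_comp.
by rewrite -(sinj_comp U _ _ (inj_comp (@lift_inj _ i) jj)).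
Qed.

Lemma proj_separates k (z : F k) :
  (forall S : {set 'I_k}, proj (F[con (set_sinj U S)] z) = 0) -> z = 0.
Proof.
move=> h; apply: proj_separates_inj => e i ii.
pose S := [set i x | x in 'I_e].
have [x|r hr] := @choice 'I_e _ (fun x y => set_val S y = i x).
  by apply: set_val_rank; apply: imset_f.
have ri : injective r by move=> x y e'; apply: ii; rewrite -!hr e'.
have -> : sinj U ii = scomp (set_sinj U S) (sinj U ri).
  rewrite -(sinj_comp U _ _ (inj_comp (@enum_val_inj _ (pred_of_set S)) ri)).
  by apply: sinj_irr => x; rewrite /= hr.
rewrite con_comp fmapM -proj_con_proj ?h ?raddf0 ?proj0 //.
move=> y; have /imsetP[x _ ex] : set_val S y \in S by apply: enum_valP.
by exists x; apply: enum_val_inj; rewrite /= ffunE hr ex.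
Qed.

(** The component at T of a term at S survives only for S = T: if S misses an
    element of T, then that letter is absent from the values; if S has an
    element outside T, then the retraction kills it, and p S is pure. *)
Lemma cross_effect_component k (p : forall S : {set 'I_k}, F #|S|) T :
  (forall S, pure (p S)) ->
  proj (F[con (set_sinj U T)] (\sum_(S : {set 'I_k}) F[cov P (set_val S)] (p S)))
  = p T.
Proof.
move=> hp; rewrite !raddf_sum [proj _](raddf_sum (@projA _)) (bigD1 T) //= big1.
  by rewrite addr0 -fmapM con_sinj_cov fmap1 proj_pure.
move=> S ST; rewrite -fmapM.
have [TS|/subsetPn[t tT tS]] := boolP (T \subset S).
  have /subsetPn[s sS sT] : ~~ (S \subset T).
    by apply: contra ST => SS; rewrite eqEsubset SS TS.
  have [s' es] := set_val_rank sS.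
  rewrite (pure_kill (i := s') (hp S)) ?proj0 //.
  by apply: con_sinj_cov_kill => t e; case/negP: sT; rewrite -es -e enum_valP.
have [t' et] := set_val_rank tT.
apply: (proj_miss (i := t')); apply: con_sinj_cov_miss => s e.
by case/negP: tS; rewrite -et -e enum_valP.
Qed.

(** The two sides have the same components, and components separate. *)
Lemma cross_effect_decomposition k (x : F k) :
  x = \sum_(S : {set 'I_k})
        F[cov P (set_val S)] (proj (F[con (set_sinj U S)] x)).
Proof.
apply/eqP; rewrite -subr_eq0; apply/eqP/proj_separates => T.
rewrite raddfB projB (cross_effect_component _ (fun S => @pure_proj _ _)).
by rewrite subrr.
Qed.
End OneFunctor.
End CrossEffectFunctor.

(** * From functors to pseudo-Mackey functors *)

Section CrossEffectJanus.
Local Open Scope ring_scope.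
Variables (P : operad) (U : unitary P).
Notation FC := (free_category P).

Section Object.
Variable F : functor FC Ab.
Notation "F[ a ]" := (fmap F a) (at level 0, format "F[ a ]").

Definition cr n : zmodType := subgroup (pure_closed U F n).

Lemma cr_low_pure n m (f : @hom Omega n m) (x : cr n) :
  pure U (F[cov P (sval f)] (sval x)).
Proof. by apply: pure_cov; [apply/surjP; case: f | case: x]. Qed.

Definition cr_low n m (f : @hom Omega n m) : {additive cr n -> cr m} :=
  corestr (pure_closed U F m)
    (f := F[cov P (sval f)] \o sg_val (pure_closed U F n))
    (cr_low_pure f).

Lemma cr_up_pure n m (phi : @hom (OmegaP U) n m) (x : cr m) :
  pure U (proj U (F[con (sval phi)] (sval x))).
Proof. exact: pure_proj. Qed.

Definition cr_up n m (phi : @hom (OmegaP U) n m) : {additive cr m -> cr n} :=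
  corestr (pure_closed U F n)
    (f := projA U F n \o F[con (sval phi)] \o
          sg_val (pure_closed U F m))
    (cr_up_pure phi).

Lemma cr_lowE n m (f : @hom Omega n m) x :
  sval (cr_low f x) = F[cov P (sval f)] (sval x).
Proof. by []. Qed.

Lemma cr_upE n m (phi : @hom (OmegaP U) n m) x :
  sval (cr_up phi x) = proj U (F[con (sval phi)] (sval x)).
Proof. by []. Qed.

Lemma cr_low_id n : cr_low (idc (n : Omega)) = idc (cr n : Ab).
Proof.
apply: additive_ext => x; apply: subgroup_ext; rewrite cr_lowE.
rewrite (_ : cov _ _ = idc (n : FC)) ?fmap1 //.
by rewrite -cov_id; apply: cov_ext => i; rewrite /= ffunE.
Qed.

Lemma cr_low_comp n m l (g : @hom Omega m l) (f : @hom Omega n m) :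
  cr_low (comp g f) = comp (cr_low g : @hom Ab _ _) (cr_low f).
Proof.
apply: additive_ext => x; apply: subgroup_ext; rewrite /= -fmapM -cov_comp.
by congr (fmap F _ _); apply: cov_ext => i; rewrite /= ffunE.
Qed.

Lemma cr_up_id n : cr_up (idc (n : OmegaP U)) = idc (cr n : Ab).
Proof.
apply: additive_ext => x; apply: subgroup_ext; rewrite cr_upE.
by rewrite [con _]con_id fmap1 proj_pure //; case: x.
Qed.

Lemma cr_up_comp n m l (g : @hom (OmegaP U) m l) (f : @hom (OmegaP U) n m) :
  cr_up (comp g f) = comp (cr_up f : @hom Ab _ _) (cr_up g).
Proof.
apply: additive_ext => x; apply: subgroup_ext.
rewrite cr_upE [con _]con_comp fmapM -proj_con_proj //.
by apply/surjP; case: f.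
Qed.

Definition cr_janus : janus U :=
  @Janus P U cr
    (@FunctorOn Omega Ab cr cr_low cr_low_id cr_low_comp)
    (@FunctorOn (opposite (OmegaP U)) Ab cr
       (fun m n phi => @cr_up n m phi) cr_up_id
       (fun l m n f g => cr_up_comp g f)).

Lemma sval_sum n (I : finType) (x : I -> cr n) :
  sval (\sum_i x i) = \sum_i sval (x i).
Proof. exact: (raddf_sum (sg_val (pure_closed U F n))). Qed.

Lemma surj_finfun n m (f : 'I_n -> 'I_m) :
  reflect (forall y, exists x, f x = y) (surj (finfun f)).
Proof.
by apply: (iffP (surjP _)) => h y; have [x <-] := h y; exists x; rewrite ffunE.
Qed.

Lemma proj_cov_miss n m (f : 'I_n -> 'I_m) x :
  ~ (forall y, exists x, f x = y) -> proj U (F[cov P f] x) = 0.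
Proof.
move=> /existsNP[y ny]; apply: (proj_miss (i := y)).
by apply: kill_cov_miss => z e; apply: ny; exists z.
Qed.

Lemma pure_con_miss n m (phi : smor P n m) x :
  pure U x -> ~ (forall y, exists x, phi x = y) -> F[con phi] x = 0.
Proof.
move=> hx /existsNP[y ny]; apply: (pure_kill (i := y) hx).
by apply: con_kill_miss => z e; apply: ny; exists z.
Qed.

(** After exchanging the legs of the square, F(con phi) x is decomposed over
    the subsets A' of A.  If phi is not onto on A', then the component of
    F(con phi) x vanishes since x is pure; if f is not onto on A', then the
    letters that f misses make the projection vanish. *)
Lemma cr_mackey : pseudo_mackey cr_janus.
Proof.
split=> [n s|A B C D f g phi psi [pb sq] x].
  apply: additive_ext => x; apply: subgroup_ext.
  rewrite [LHS]/= -/(proj U _).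
  set ss := sinj U _; have -> : cov P (finfun s) = cov P s.
    by apply: cov_ext => i; rewrite ffunE.
  (* [con ss] is a left inverse of [cov s], hence equal to its two-sided one. *)
  have e : cov P (s^-1)%g = con ss.
    rewrite -[LHS](comp1c) -(con_sinj_cov U (@perm_inj _ s)) -compA -cov_comp.
    by rewrite cov_id_ext ?compc1 // => i; rewrite permKV.
  rewrite proj_pure -?e.
    by rewrite -fmapM -cov_comp cov_id_ext ?fmap1 // => i; rewrite permKV.
  by apply: pure_cov (svalP x) => y; exists (s y); rewrite permK.
apply: subgroup_ext; rewrite sval_sum.
transitivity (proj U (F[con (sval psi)] (F[cov P (sval g)] (sval x)))); first by [].
rewrite -fmapM ((pullback_square pb).1 sq) fmapM.
rewrite [F[con (sval phi)] _](cross_effect_decomposition U).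
rewrite raddf_sum [LHS](raddf_sum (projA U F _)) /=.
rewrite (bigID (admissible f phi)) /= [X in _ + X]big1 ?addr0; last first.
  move=> A' nA; rewrite -fmapM -con_comp -fmapM -cov_comp.
  have [sf|nf] := boolP (surj (restr (sval f) A')); last first.
    apply: proj_cov_miss => /surj_finfun; apply/negP.
    by apply: contra nf; congr surj; apply/ffunP => i; rewrite !ffunE.
  rewrite (pure_con_miss (svalP x)) ?proj0 ?raddf0 ?proj0 //.
  by move=> h; case/negP: nA; apply/andP; split=> //; apply/surjP.
rewrite (reindex_omap (fun A' : Adm f phi => val A') insub) /=; last first.
  by move=> A' aA; rewrite insubT.
apply: eq_big => [A'|A' _]; first by rewrite valK eqxx andbT; case: A'.
rewrite -fmapM -con_comp -fmapM -cov_comp.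
transitivity (F[cov P (sval (om_restr A'))]
  (proj U (F[con (sval (omP_restr A'))] (sval x)))); last by [].
have -> : cov P (sval (om_restr A')) =
    cov P (fun i => sval f (set_val (val A') i)).
  by apply: cov_ext => i; rewrite /= ffunE.
rewrite proj_pure //; apply: pure_cov; last exact: pure_proj.
by case: A' => A' /= /andP[/surjP h _] y; have [z <-] := h y; exists z; rewrite ffunE.
Qed.
End Object.

Section Vanishing.
Variables (n : nat) (F : functor FC Ab).
Hypothesis Fred : reduced (free_zero U) F.
Hypothesis Fpol : polynomial_of_degree_le (free_zero U) (free_coproducts P) F n.

Lemma cr_trivial0 : is_trivial (cr F 0).
Proof. by move=> x; apply: subgroup_ext; apply: Fred. Qed.

Lemma zero_morE (A B : FC) (a : free_algebra P 'I_A) :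
  (zero_mor (free_zero U) A B : alg_hom _ _) a = pt U (free_algebra P 'I_B).
Proof.
pose z : alg_hom (free_algebra P 'I_0) (free_algebra P 'I_B) :=
  zfrom (free_zero U) B.
exact: etrans (congr1 z (free0_uniq U _ (pt U _))) (alg_hom_pt U z).
Qed.

(** The retraction that kills a nonempty block factors through killing one of
    its generators, so that x lies in the cross effect of the n+1 blocks. *)
Lemma pure_blocks (X : 'I_n.+1 -> nat) (x : F (\sum_i X i)%N) :
  (forall i, 0 < X i)%N -> pure U x -> x = 0.
Proof.
move=> X0 hx; apply: (Fpol (X := X)) => k.
apply: (pure_kill (i := tagnat.Rank k (Ordinal (X0 k))) hx).
apply: kill_fixes.
have := retraction_eq (free_zero U) (free_coproducts P) X k.
move=> /(congr1 (fun a : @hom FC _ _ => gen a (Ordinal (X0 k)))).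
rewrite [gen (zero_mor _ _ _) _]zero_morE => <-.
by rewrite gen_comp [gen (cinj _ _ _) _]free_injE.
Qed.

Lemma cr_trivial k : (n < k)%N -> is_trivial (cr F k).
Proof.
move=> nk [x hx]; apply: subgroup_ext => /=.
have [X [X0 sX]] : exists X : 'I_n.+1 -> nat,
    (forall i, 0 < X i)%N /\ (\sum_i X i)%N = k.
  (* One block of size k - n and n blocks of size 1. *)
  exists (fun i => if i == ord0 then (k - n)%N else 1%N); split=> [i|].
    by case: eqP => // _; rewrite subn_gt0.
  rewrite big_ord_recl /= (eq_bigr (fun=> 1%N)) // sum1_card card_ord.
  by rewrite subnK // ltnW.
by case: _ / sX in x hx nk *; apply: pure_blocks.
Qed.
End Vanishing.

Section Morphism.
Variables (F G : functor FC Ab) (t : nat_trans F G).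

Lemma nt_fmap n m (a : @hom FC n m) (x : F n) :
  t m (fmap F a x) = fmap G a (t n x).
Proof. exact: (congr1 (fun h : {additive F n -> G m} => h x) (nt_natural t a)). Qed.

Lemma nt_proj n (x : F n) : t n (proj U x) = proj U (t n x).
Proof.
rewrite /proj; elim: (enum _) => //= i s IH.
by rewrite raddfB nt_fmap IH.
Qed.

Lemma cr_map_pure n (x : cr F n) : pure U (t n (sval x)).
Proof. by move=> i; rewrite -nt_fmap (svalP x) raddf0. Qed.

Definition cr_map n : {additive cr F n -> cr G n} :=
  corestr (pure_closed U G n) (f := t n \o sg_val (pure_closed U F n))
    (@cr_map_pure n).

Lemma cr_map_low n m (f : @hom Omega n m) :
  comp (cr_map m : @hom Ab _ _) (jlow (cr_janus F) f) =
  comp (jlow (cr_janus G) f) (cr_map n : @hom Ab (cr F n) _).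
Proof. by apply: additive_ext => x; apply: subgroup_ext; apply: nt_fmap. Qed.

Lemma cr_map_up n m (u : @hom (OmegaP U) n m) :
  comp (cr_map n : @hom Ab _ _) (jup (cr_janus F) u) =
  comp (jup (cr_janus G) u) (cr_map m : @hom Ab (cr F m) _).
Proof.
apply: additive_ext => x; apply: subgroup_ext; apply: etrans (nt_proj _) _.
by congr (proj U _); apply: nt_fmap.
Qed.

Definition cr_janus_hom : janus_hom (cr_janus F) (cr_janus G) :=
  @JanusHom _ _ (cr_janus F) (cr_janus G) cr_map cr_map_low cr_map_up.
End Morphism.

Variable n : nat.
Notation Poly := (reduced_polynomial_functors U n).
Notation Mack := (pseudo_mackey_functors_le U n).

Definition cr_ob (F : Poly) : Mack :=
  exist _ (cr_janus (sval F))
    (conj (cr_mackey (sval F))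
       (conj (cr_trivial0 (svalP F).1) (cr_trivial (svalP F).2))).

Lemma cr_functor_id (F : Poly) :
  cr_janus_hom (nt_id (sval F)) = janus_id (cr_janus (sval F)).
Proof.
by apply: janus_hom_ext => k; apply: additive_ext => x; apply: subgroup_ext.
Qed.

Lemma cr_functor_comp (F G H : Poly) (t : @hom Poly G H) (s : @hom Poly F G) :
  cr_janus_hom (nt_comp t s) = janus_comp (cr_janus_hom t) (cr_janus_hom s).
Proof.
by apply: janus_hom_ext => k; apply: additive_ext => x; apply: subgroup_ext.
Qed.

Definition cr_functor : functor Poly Mack :=
  @Functor Poly Mack cr_ob
    (@FunctorOn Poly Mack cr_ob (fun F G t => cr_janus_hom t)
       cr_functor_id cr_functor_comp).
End CrossEffectJanus.

(** * Transfers extended by zero *)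

Definition onto n m (f : 'I_n -> 'I_m) : Prop := forall y, exists x, f x = y.

Lemma onto_ext n m (f g : 'I_n -> 'I_m) : f =1 g -> onto f -> onto g.
Proof. by move=> e h y; have [x <-] := h y; exists x. Qed.

Lemma onto_left n m l (g : 'I_m -> 'I_l) (f : 'I_n -> 'I_m) :
  onto (fun x => g (f x)) -> onto g.
Proof. by move=> h z; have [x <-] := h z; exists (f x). Qed.

Lemma onto_card n m (f : 'I_n -> 'I_m) : onto f -> #|'I_m| <= #|'I_n|.
Proof.
move=> hf; have [y|r hr] := @choice _ _ (fun y x => f x = y); first exact: hf.
by apply: (leq_card r) => t u e; rewrite -[t]hr -[u]hr e.
Qed.

Section TotalJanus.
Local Open Scope ring_scope.
Variables (P : operad) (U : unitary P) (M : janus U).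
Notation FC := (free_category P).

Lemma zeroB (A B : zmodType) (x y : A) : (0 : B) = 0 - 0.
Proof. by rewrite subr0. Qed.

Definition zero_map (A B : zmodType) : {additive A -> B} :=
  add_map (@zeroB A B).

(** Extending both transfers by zero to all maps turns the sum over admissible
    subsets into a sum over all subsets, which can be reindexed freely. *)
Definition low n m (f : 'I_n -> 'I_m) : {additive M n -> M m} :=
  match @idP (surj (finfun f)) with
  | ReflectT h => jlow M (exist _ (finfun f) h : @hom Omega n m)
  | ReflectF _ => zero_map _ _
  end.

Definition up n m (phi : smor P n m) : {additive M m -> M n} :=
  match @idP (surj (sfun phi)) with
  | ReflectT h => jup M (exist _ phi h : @hom (OmegaP U) n m)
  | ReflectF _ => zero_map _ _
  end.

Lemma low_hom n m (f : @hom Omega n m) (g : 'I_n -> 'I_m) x :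
  (forall i, g i = sval f i) -> low g x = jlow M f x.
Proof.
case: f => f hf /= e; have {}e : finfun g = f by apply/ffunP => i; rewrite ffunE e.
rewrite /low; case: {-}_ / idP => [h|]; last by rewrite e hf.
by congr (jlow M _ x); apply: wide_hom_ext.
Qed.

Lemma low_miss n m (f : 'I_n -> 'I_m) x : ~ onto f -> low f x = 0.
Proof.
move=> nf; rewrite /low; case: {-}_ / idP => // h.
by case: nf; apply/surj_finfun.
Qed.

Lemma low_ext n m (f g : 'I_n -> 'I_m) x : f =1 g -> low f x = low g x.
Proof. by move=> /funext ->. Qed.

Lemma up_hom n m (phi : @hom (OmegaP U) n m) x : up (sval phi) x = jup M phi x.
Proof.
case: phi => phi hf /=; rewrite /up; case: {-}_ / idP => [h|]; last by rewrite hf.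
by congr (jup M _ x); apply: wide_hom_ext.
Qed.

Lemma up_miss n m (phi : smor P n m) x : ~ onto phi -> up phi x = 0.
Proof.
by move=> nf; rewrite /up; case: {-}_ / idP => // h; case: nf; apply/surjP.
Qed.

Lemma low_comp n m l (g : 'I_m -> 'I_l) (f : 'I_n -> 'I_m) x :
  onto f -> low (fun i => g (f i)) x = low g (low f x).
Proof.
move=> hf; case: (pselect (onto g)) => [hg|ng]; last first.
  by rewrite !low_miss // => /onto_left.
have [hf' hg'] := (introT (surj_finfun _) hf, introT (surj_finfun _) hg).
pose f' : @hom Omega n m := exist _ (finfun f) hf'.
pose g' : @hom Omega m l := exist _ (finfun g) hg'.
rewrite (@low_hom _ _ f') ?(@low_hom _ _ g') ?(@low_hom _ _ (comp g' f')).
- by rewrite /jlow farr_comp.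
- by move=> i; rewrite /= !ffunE.
- by move=> i; rewrite /= ffunE.
- by move=> i; rewrite /= ffunE.
Qed.

Lemma up_comp n m l (psi : smor P m l) (rho : smor P n m) x :
  onto rho -> up (scomp psi rho) x = up rho (up psi x).
Proof.
move=> hr; case: (pselect (onto psi)) => [hp|np]; last first.
  rewrite (up_miss _ np) raddf0 up_miss // => h; apply: np.
  by move=> z; have [y <-] := h z; exists (rho y); rewrite /= ffunE.
pose r : @hom (OmegaP U) n m := exist _ rho (introT (surjP _) hr).
pose p : @hom (OmegaP U) m l := exist _ psi (introT (surjP _) hp).
rewrite -[rho]/(sval r) -[psi]/(sval p) -[scomp _ _]/(sval (comp p r)) !up_hom.
by rewrite /jup (@farr_comp _ _ _ (jcontra M) _ _ _ r p).
Qed.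

Hypothesis MM : pseudo_mackey M.

(** The pseudo-Mackey condition on double isomorphisms: it makes the choice of
    an enumeration of a subset immaterial. *)
Lemma low_up_bij n (s : 'I_n -> 'I_n) (si : injective s) x :
  low s (up (sinj U si) x) = x.
Proof.
have := congr1 (fun h : {additive M n -> M n} => h x) (mackey_iso MM (perm si)).
apply: etrans; rewrite /= -up_hom -(@low_hom _ _ (om_perm _) s); last first.
  by move=> i; rewrite /= ffunE permE.
suff -> : sinj U si = sval (omP_perm U (perm si)) by [].
by apply: sinj_irr => i; rewrite permE.
Qed.

Lemma low_up_inj n m (s : 'I_n -> 'I_m) (si : injective s) x :
  onto s -> low s (up (sinj U si) x) = x.
Proof.
move=> hs; have nm : n = m.
  have := leq_card s si; have := onto_card hs; rewrite !card_ord => mn nm.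
  by apply/eqP; rewrite eqn_leq nm.
by case: _ / nm in s si x hs *; apply: low_up_bij.
Qed.

Lemma up_low_square A B C D (f : 'I_A -> 'I_B) (g : 'I_C -> 'I_D)
    (phi : smor P A C) (psi : smor P B D) x :
  is_pullback f g phi psi ->
  comp (con psi) (cov P g) = comp (cov P f) (con phi) ->
  onto g -> onto psi ->
  up psi (low g x) = \sum_(A' : {set 'I_A})
    low (fun i => f (set_val A' i)) (up (scomp phi (set_sinj U A')) x).
Proof.
move=> pb e hg hp.
have hf : onto f.
  move=> b; have [c ec] := hg (psi b); have [a [[<- _] _]] := pb.2 b c (esym ec).
  by exists a.
have hphi : onto phi.
  move=> c; have [b eb] := hp (g c); have [a [[_ <-] _]] := pb.2 b c eb.
  by exists a.
pose f' : @hom Omega A B := exist _ (finfun f) (introT (surj_finfun _) hf).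
pose g' : @hom Omega C D := exist _ (finfun g) (introT (surj_finfun _) hg).
pose phi' : @hom (OmegaP U) A C := exist _ phi (introT (surjP _) hphi).
pose psi' : @hom (OmegaP U) B D := exist _ psi (introT (surjP _) hp).
have sq : is_square f' g' phi' psi'.
  have pb' : is_pullback (finfun f) (finfun g) phi psi.
    split=> [a|b c]; first by rewrite !ffunE pb.1.
    rewrite ffunE => ebc; have [a [[e1 e2] u]] := pb.2 b c ebc.
    by exists a; split=> [|a']; rewrite ffunE //; apply: u.
  exists pb'; apply/(pullback_square pb').
  by rewrite (cov_ext P (ffunE g)) (cov_ext P (ffunE f)).
rewrite -[psi]/(sval psi') up_hom (@low_hom _ _ g') => [|i]; last by rewrite /= ffunE.
rewrite (mackey_square MM sq).
rewrite (bigID (admissible f' phi')) /= [X in _ = _ + X]big1 ?addr0; last first.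
  move=> A' nA; case: (pselect (onto (scomp phi (set_sinj U A')))) => h1; last first.
    by rewrite (up_miss _ h1) raddf0.
  apply: low_miss => h2; case/negP: nA; apply/andP; split; last exact/surjP.
  by apply/surjP => y; have [z <-] := h2 y; exists z; rewrite !ffunE.
rewrite [RHS](reindex_omap (fun A' : Adm f' phi' => val A') insub) /=; last first.
  by move=> A' aA; rewrite insubT.
apply: eq_big => [A'|A' _]; first by rewrite valK eqxx andbT; case: A'.
rewrite -up_hom -(low_hom (g := fun i => f (set_val (val A') i))) // => i.
by rewrite /= !ffunE.
Qed.

End TotalJanus.

(** * From pseudo-Mackey functors to functors: coherent families *)

Section CoherentFamilies.
Local Open Scope ring_scope.
Variables (P : operad) (U : unitary P).
Notation FC := (free_category P).

Section Object.
Variable M : janus U.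

(** The index type is spelled out as homomorphisms of algebras, rather than
    arrows of the category, to keep the product in the universe of abelian
    groups. *)
Definition family (k : nat) : zmodType :=
  big_prod (fun d : nat =>
    (big_prod (fun _ : alg_hom (free_algebra P 'I_k) (free_algebra P 'I_d) =>
       ab_zmod (M d)) : zmodType)).

Lemma familyB k (x y : family k) d (a : @hom FC k d) :
  (x - y) d a = x d a - y d a.
Proof. by []. Qed.

Definition up_coherent k (y : family k) : Prop :=
  forall d d' (rho : @hom (OmegaP U) d' d) (a : @hom FC k d),
    y d' (comp (con (sval rho)) a) = jup M rho (y d a).

(** If y_a is the top cross effect component of an element z of F(d), then the
    right-hand side is the top component of F(cov g) z, computed from the
    decomposition of z over the subsets of d. *)
Definition low_coherent k (y : family k) : Prop :=
  forall d d' (g : 'I_d -> 'I_d') (a : @hom FC k d),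
    y d' (comp (cov P g) a) = \sum_(S : {set 'I_d})
      low M (fun i => g (set_val S i)) (y _ (comp (con (set_sinj U S)) a)).

Definition coherent k (y : family k) := up_coherent y /\ low_coherent y.

Lemma coherent_closed k : sub_closed (@coherent k).
Proof.
split=> [|x y [x1 x2] [y1 y2]]; split=> [d d' rho a|d d' g a].
- by rewrite raddf0.
- by rewrite big1 // => S _; rewrite raddf0.
- by rewrite !familyB x1 y1 -raddfB.
- rewrite familyB x2 y2 -sumrB; apply: eq_bigr => S _.
  by rewrite -raddfB.
Qed.

Definition coh k : zmodType := subgroup (coherent_closed k).

Definition precomp k l (b : @hom FC k l) (y : family k) : family l :=
  fun d (a : @hom FC l d) => y d (comp a b).

Lemma precomp_coherent k l (b : @hom FC k l) (y : coh k) :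
  coherent (precomp b (sval y)).
Proof.
have [y1 y2] := svalP y.
split=> [d d' rho a|d d' g a]; rewrite /precomp -[comp (comp _ a) b]compA.
  exact: y1.
by rewrite y2; apply: eq_bigr => S _; rewrite -compA.
Qed.

Definition coh_fun k l (b : @hom FC k l) (y : coh k) : coh l :=
  exist _ (precomp b (sval y)) (precomp_coherent b y).

Lemma coh_funB k l (b : @hom FC k l) (x y : coh k) :
  coh_fun b (x - y) = coh_fun b x - coh_fun b y.
Proof. exact: subgroup_ext. Qed.

Definition coh_map k l (b : @hom FC k l) : {additive coh k -> coh l} :=
  add_map (@coh_funB k l b).

Lemma coh_ext k (x y : coh k) :
  (forall d (a : @hom FC k d), sval x d a = sval y d a) -> x = y.
Proof.
move=> e; apply: subgroup_ext; apply: big_prod_ext => d.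
by apply: big_prod_ext => a; apply: e.
Qed.

Lemma coh_map_id k : coh_map (idc (k : FC)) = idc (coh k : Ab).
Proof.
apply: additive_ext => y; apply: coh_ext => d a.
by rewrite /= /precomp compc1.
Qed.

Lemma coh_map_comp k l m (c : @hom FC l m) (b : @hom FC k l) :
  coh_map (comp c b) = comp (coh_map c : @hom Ab _ _) (coh_map b).
Proof.
apply: additive_ext => y; apply: coh_ext => d a.
by rewrite /= /precomp compA.
Qed.

Definition coh_functor : functor FC Ab :=
  @Functor FC Ab coh (@FunctorOn FC Ab coh coh_map coh_map_id coh_map_comp).

Lemma coh_up k (y : coh k) d d' (rho : smor P d' d) (a : @hom FC k d) :
  onto rho -> sval y d' (comp (con rho) a) = up M rho (sval y d a).
Proof.
move=> hr; pose r : @hom (OmegaP U) d' d := exist _ rho (introT (surjP _) hr).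
by rewrite -[rho]/(sval r) up_hom; apply: (svalP y).1.
Qed.

Lemma coh_low k (y : coh k) d d' (g : 'I_d -> 'I_d') (a : @hom FC k d) :
  sval y d' (comp (cov P g) a) = \sum_(S : {set 'I_d})
      low M (fun i => g (set_val S i)) (sval y _ (comp (con (set_sinj U S)) a)).
Proof. exact: (svalP y).2. Qed.

Lemma image_factor n k (phi : smor P n k) :
  exists (T : {set 'I_k}) (rho : smor P n #|T|),
    onto rho /\ phi = scomp (set_sinj U T) rho.
Proof.
pose T := [set phi x | x in 'I_n].
have [x|r hr] := @choice 'I_n _ (fun x y => set_val T y = phi x).
  by apply: set_val_rank; apply: imset_f.
have [rho [e1 e2]] :=
  @smor_factor P U _ _ _ phi _ (@enum_val_inj _ (pred_of_set T)) r hr.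
exists T, rho; split=> // y.
have /imsetP[x _ ex] : set_val T y \in T by apply: enum_valP.
by exists x; apply: enum_val_inj; rewrite e1 hr.
Qed.

(** Coherence expresses y at a span through the values y (con phi'), with phi'
    the restrictions of its decorated leg, and y (con phi') through the value
    at the retraction onto the image of phi'. *)
Lemma coh_separates k (y : coh k) :
  (forall S : {set 'I_k}, sval y _ (con (set_sinj U S)) = 0) -> y = 0.
Proof.
move=> h; apply: coh_ext => d a; have [X [phi [f ->]]] := free_span a.
rewrite coh_low big1 // => S _; rewrite -con_comp.
have [T [rho [hr ->]]] := image_factor (scomp phi (set_sinj U S)).
by rewrite con_comp coh_up // h !raddf0.
Qed.

(** If the letter t is absent, then a factors through the inclusion of the
    other generators, on no subset of which the inclusion is onto. *)
Lemma coh_miss k (y : coh k) d (a : @hom FC k d) t :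
  comp (kill U t) a = a -> sval y d a = 0.
Proof.
case: d t a => [[] //|d] t a <-.
rewrite kill_factor -compA coh_low big1 // => S _.
by apply: low_miss => /(_ t) [x e]; case/eqP: (neq_lift t (set_val S x)).
Qed.

Lemma coh_reduced : is_trivial (M 0) -> is_trivial (coh 0).
Proof.
move=> M0 y; apply: coh_separates => S.
have S0 : #|S| = 0%N by apply: eq_card0 => -[].
have: is_trivial (M #|S|) by rewrite S0.
exact.
Qed.

Lemma coh_polynomial n : (forall k, n < k -> is_trivial (M k))%N ->
  polynomial_of_degree_le (free_zero U) (free_coproducts P) coh_functor n.
Proof.
move=> Mn X y hy; apply: coh_separates => S.
move: (@enum_val_inj _ (pred_of_set S)); move: (set_val S) => i ii.
move: #|_| i ii => e i ii.
(* Case 1: the injection i meets all n+1 blocks, hence e > n.  Case 2: it misses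
   block k, and [con] of i is b after the retraction that kills this block. *)
have [hit|/existsNP[k nk]] := pselect (onto (fun x => blk (i x))).
  by apply: Mn; have := onto_card hit; rewrite !card_ord.
have {}nk x : blk (i x) <> k by move=> ex; apply: nk; exists x.
set K := free_coproducts P; set Z := free_zero U in hy *.
pose b : @hom FC (cop K (fun j => X (lift k j))) e :=
  comp (con (sinj U ii)) (copair K (fun j => cinj K X (lift k j))).
suff -> : con (sinj U ii) = comp b (retraction Z K X k).
  exact: (congr1 (fun z : coh _ => sval z e b) (hy k)).
apply: (@copair_uniq _ K) => l; rewrite -compA.
case: (unliftP k l) => [j ->|->]; first by rewrite retraction_neq -compA copairE.
rewrite retraction_eq; apply: gen_ext => t.
rewrite [RHS]gen_comp [gen (zero_mor _ _ _) _]zero_morE alg_hom_pt.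
rewrite [LHS]gen_comp [gen (cinj _ _ _) t]free_injE.
rewrite -[LHS]/(gen (con (sinj U ii)) _) gen_fsub semb_sinj_nil // => x ex.
by apply: (nk x); rewrite ex; exact: (Rank_eq erefl).1.
Qed.
End Object.
End CoherentFamilies.

(** * Unit and counit *)

Section CoherentFunctor.
Local Open Scope ring_scope.
Variables (P : operad) (U : unitary P).
Notation FC := (free_category P).

Section Morphism.
Variables (M N : janus U) (t : janus_hom M N).

Lemma jh_lowE n m (f : @hom Omega n m) x : t m (jlow M f x) = jlow N f (t n x).
Proof. exact: (congr1 (fun h : {additive M n -> N m} => h x) (jh_low t f)). Qed.

Lemma jh_upE n m (u : @hom (OmegaP U) n m) x : t n (jup M u x) = jup N u (t m x).
Proof. exact: (congr1 (fun h : {additive M m -> N n} => h x) (jh_up t u)). Qed.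

Lemma jh_low_total n m (f : 'I_n -> 'I_m) x : t m (low M f x) = low N f (t n x).
Proof.
case: (pselect (onto f)) => [hf|nf]; last by rewrite !low_miss ?raddf0.
pose g : @hom Omega n m := exist _ (finfun f) (introT (surj_finfun _) hf).
by rewrite !(@low_hom _ _ _ _ _ g) ?jh_lowE // => i; rewrite /= ffunE.
Qed.

Lemma coh_nat_coherent k (y : coh M k) :
  coherent (fun d (a : @hom FC k d) => t d (sval y d a) : N d).
Proof.
split=> [d d' rho a|d d' g a]; first by rewrite (svalP y).1 jh_upE.
by rewrite coh_low raddf_sum; apply: eq_bigr => S _; apply: jh_low_total.
Qed.

Definition coh_nat_fun k (y : coh M k) : coh N k :=
  exist _ _ (coh_nat_coherent y).

Lemma coh_nat_funB k (x y : coh M k) :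
  coh_nat_fun (x - y) = coh_nat_fun x - coh_nat_fun y.
Proof. by apply: coh_ext => d a; apply: raddfB. Qed.

Definition coh_nat_map k : {additive coh M k -> coh N k} :=
  add_map (@coh_nat_funB k).

Lemma coh_nat_natural k l (b : @hom FC k l) :
  comp (coh_nat_map l : @hom Ab _ _) (fmap (coh_functor M) b) =
  comp (fmap (coh_functor N) b) (coh_nat_map k : @hom Ab (coh M k) _).
Proof. by apply: additive_ext => y; apply: coh_ext. Qed.

Definition coh_nat : nat_trans (coh_functor M) (coh_functor N) :=
  @NatTrans _ _ (coh_functor M) (coh_functor N) coh_nat_map coh_nat_natural.
End Morphism.

Section Bounded.
Variable n : nat.
Notation Poly := (reduced_polynomial_functors U n).
Notation Mack := (pseudo_mackey_functors_le U n).

Definition coh_ob (M : Mack) : Poly :=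
  exist _ (coh_functor (sval M))
    (conj (coh_reduced (svalP M).2.1) (coh_polynomial (svalP M).2.2)).

Lemma coh_functor_id (M : Mack) :
  coh_nat (janus_id (sval M)) = nt_id (coh_functor (sval M)).
Proof.
by apply: nat_trans_ext => k; apply: additive_ext => y; apply: coh_ext.
Qed.

Lemma coh_functor_comp (L M N : Mack) (t : @hom Mack M N) (s : @hom Mack L M) :
  coh_nat (janus_comp t s) = nt_comp (coh_nat t) (coh_nat s).
Proof.
by apply: nat_trans_ext => k; apply: additive_ext => y; apply: coh_ext.
Qed.

Definition coherent_functor : functor Mack Poly :=
  @Functor Mack Poly coh_ob
    (@FunctorOn Mack Poly coh_ob (fun M N t => coh_nat t)
       coh_functor_id coh_functor_comp).

End Bounded.

Section Unit.
Variable F : functor FC Ab.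

Lemma cr_low_total n m (f : 'I_n -> 'I_m) (x : cr U F n) :
  sval (low (cr_janus U F) f x) = proj U (fmap F (cov P f) (sval x)).
Proof.
case: (pselect (onto f)) => [hf|nf]; last by rewrite low_miss // proj_cov_miss.
pose g : @hom Omega n m := exist _ (finfun f) (introT (surj_finfun _) hf).
rewrite (@low_hom _ _ _ _ _ g) => [|i]; last by rewrite /= ffunE.
rewrite [LHS]/= (cov_ext P (ffunE f)) proj_pure //.
by apply: pure_cov hf (svalP x).
Qed.

(** The example from which the conditions on coherent families are
    abstracted. *)
Definition unit_family k (x : F k) : family (cr_janus U F) k :=
  fun d (a : @hom FC k d) =>
    exist _ (proj U (fmap F a x)) (pure_proj U (fmap F a x)) : cr U F d.

Lemma unit_coherent k (x : F k) : coherent (unit_family x).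
Proof.
split=> [d d' rho a|d d' g a]; apply: subgroup_ext; rewrite ?sval_sum /= fmapM.
  rewrite proj_con_proj //; apply/surjP; exact: (svalP rho).
rewrite [fmap F a x](cross_effect_decomposition U) raddf_sum.
rewrite [LHS](raddf_sum (projA U F _)); apply: eq_bigr => S _.
rewrite cr_low_total (cov_comp P g (set_val S)) fmapM.
by rewrite -[fmap F (con (set_sinj U S)) (fmap F a x)]fmapM.
Qed.

Definition unit_fun k (x : F k) : coh (cr_janus U F) k :=
  exist _ _ (unit_coherent x).

Lemma unit_funE k (x : F k) d (a : @hom FC k d) :
  sval (sval (unit_fun x) d a) = proj U (fmap F a x).
Proof. by []. Qed.

Lemma unit_funB k (x y : F k) : unit_fun (x - y) = unit_fun x - unit_fun y.
Proof.
apply: coh_ext => d a; apply: subgroup_ext; rewrite unit_funE raddfB.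
exact: projB.
Qed.

Definition unit_map k : {additive F k -> coh (cr_janus U F) k} :=
  add_map (@unit_funB k).

Lemma unit_natural k l (b : @hom FC k l) :
  comp (unit_map l : @hom Ab _ _) (fmap F b) =
  comp (fmap (coh_functor (cr_janus U F)) b) (unit_map k : @hom Ab _ _).
Proof.
apply: additive_ext => x; apply: coh_ext => d a; apply: subgroup_ext.
by rewrite [LHS]unit_funE [RHS]unit_funE fmapM.
Qed.

Definition unit_nt : nat_trans F (coh_functor (cr_janus U F)) :=
  @NatTrans _ _ F (coh_functor (cr_janus U F)) unit_map unit_natural.

(** A preimage of y is assembled from its components at the retractions onto
    subsets. *)
Lemma unit_bijective k : bijective (unit_map k).
Proof.
apply: additive_bij => [x ux|y].
  apply: (proj_separates (U := U)) => S.
  by rewrite -unit_funE -[unit_fun x]/(unit_map k x) ux.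
pose p (S : {set 'I_k}) : cr U F #|S| := sval y _ (con (set_sinj U S)).
exists (\sum_S fmap F (cov P (set_val S)) (sval (p S))).
apply/eqP; rewrite -subr_eq0; apply/eqP/coh_separates => T.
apply/eqP; rewrite [sval _ _ _]familyB subr_eq0; apply/eqP/subgroup_ext.
rewrite unit_funE (cross_effect_component (U := U) (p := fun S => sval (p S))) //.
by move=> S; apply: svalP.
Qed.
End Unit.

Section Counit.
Variable M : janus U.
Hypothesis MM : pseudo_mackey M.
Notation R := (coh_functor M).

(** The retraction onto a proper subset kills a generator. *)
Lemma pure_coh k (y : coh M k) (S : {set 'I_k}) :
  pure U (y : R k) -> S != setT -> sval y _ (con (set_sinj U S)) = 0.
Proof.
move=> hy ST; have [i iS] : exists i, i \notin S.
  apply/existsP; rewrite -negb_forall; apply: contra ST => /forallP h.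
  by apply/eqP/setP => i; rewrite h inE.
have := congr1 (fun z : coh M k => sval z _ (con (set_sinj U S))) (hy i).
rewrite [X in X = _]/= /precomp con_kill_miss // => x; rewrite /= ffunE => e.
by case/negP: iS; rewrite -e enum_valP.
Qed.

Lemma onto_setT k : onto (set_val [set: 'I_k]).
Proof. by move=> x; apply: set_val_rank; rewrite inE. Qed.

Lemma onto_sinj n m (i : 'I_n -> 'I_m) (ii : injective i) :
  onto i -> onto (sinj U ii).
Proof. by apply: onto_ext => x; rewrite /= ffunE. Qed.

Lemma coh_con k (y : coh M k) n (phi : smor P n k) : onto phi ->
  sval y _ (con phi) = up M phi (sval y k (idc (k : FC))).
Proof. by move=> hp; rewrite -coh_up // compc1. Qed.

Definition counit_fun k (z : cr U R k) : M k :=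
  sval (sval z : coh M k) k (idc (k : FC)).

Lemma counit_funB k (x y : cr U R k) :
  counit_fun (x - y) = counit_fun x - counit_fun y.
Proof. by []. Qed.

Definition counit_map k : {additive cr U R k -> M k} := add_map (@counit_funB k).

(** In the coherence formula for y at [cov f], purity leaves only the term of
    the full subset. *)
Lemma counit_low n m (f : @hom Omega n m) :
  comp (counit_map m : @hom Ab _ _) (jlow (cr_janus U R) f) =
  comp (jlow M f) (counit_map n : @hom Ab (cr U R n) _).
Proof.
apply: additive_ext => -[y hy]; rewrite /= /counit_fun /= /precomp.
transitivity (sval (y : coh M n) m (comp (cov P (sval f)) (idc (n : FC)))).
  by rewrite comp1c compc1.
rewrite coh_low (bigD1 setT) // big1 => [|S /andP[_ ST]]; last first.
  by rewrite compc1 pure_coh ?raddf0.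
rewrite compc1 /= addr0 coh_con; last exact/onto_sinj/onto_setT.
rewrite low_comp; last exact: onto_setT.
by rewrite low_up_inj //; [apply: low_hom | apply: onto_setT].
Qed.

Lemma counit_up n m (u : @hom (OmegaP U) n m) :
  comp (counit_map n : @hom Ab _ _) (jup (cr_janus U R) u) =
  comp (jup M u) (counit_map m : @hom Ab (cr U R m) _).
Proof.
apply: additive_ext => -[y hy]; rewrite /= /counit_fun.
have evB (x z : R n) : sval (x - z : coh M n) n (idc (n : FC)) =
    sval (x : coh M n) n (idc (n : FC)) - sval (z : coh M n) n (idc (n : FC)) by [].
rewrite [LHS](proj_absorb (L := add_map evB)) => [|i w]; last first.
  have e : comp (kill U i) (comp (idc (n : FC)) (kill U i)) =
      comp (idc (n : FC)) (kill U i) by rewrite comp1c kill_idem.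
  exact: (coh_miss (w : coh M n) e).
rewrite /= /precomp comp1c coh_con ?up_hom //; exact/surjP/(svalP u).
Qed.

Definition counit_hom : janus_hom (cr_janus U R) M :=
  @JanusHom _ _ (cr_janus U R) M counit_map counit_low counit_up.

Lemma counit_inj k (z : cr U R k) : counit_map k z = 0 -> z = 0.
Proof.
case: z => y hy /= e; apply: subgroup_ext; apply: coh_separates => S.
have [->|ST] := eqVneq S setT; last exact: pure_coh.
rewrite coh_con; first by rewrite [sval _ _ _]e raddf0.
exact/onto_sinj/onto_setT.
Qed.
End Counit.
End CoherentFunctor.

(** * Extending an element to a coherent family *)

Section SpanExtension.
Local Open Scope ring_scope.
Variables (P : operad) (U : unitary P) (M : janus U).
Hypothesis MM : pseudo_mackey M.
Notation FC := (free_category P).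
Variables (k : nat) (m : M k).

(** The contribution of one subset of the apex, given by an enumeration i of
    it, to the transfer of m along the span. *)
Definition part d X (f : 'I_X -> 'I_d) (phi : smor P X k) e (i : 'I_e -> 'I_X)
    (ii : injective i) : M d :=
  low M (fun x => f (i x)) (up M (scomp phi (sinj U ii)) m).

Notation set_part f phi S := (part f phi (@enum_val_inj _ (pred_of_set S))).

Definition span_sum d X (f : 'I_X -> 'I_d) (phi : smor P X k) : M d :=
  \sum_(S : {set 'I_X}) set_part f phi S.

(** Two enumerations of a subset differ by a bijection s, and M_*(s) M^*(s) is
    the identity. *)
Lemma part_image d X (f : 'I_X -> 'I_d) (phi : smor P X k) e e'
    (i : 'I_e -> 'I_X) (j : 'I_e' -> 'I_X) (ii : injective i) (jj : injective j) :
  (forall x, exists y, i y = j x) -> (forall y, exists x, j x = i y) ->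
  part f phi ii = part f phi jj.
Proof.
move=> ij ji; have [//|s hs] := @choice _ _ (fun x y => i y = j x).
have si : injective s by move=> x y e0; apply: jj; rewrite -!hs e0.
have so : onto s.
  by move=> y; have [x ex] := ji y; exists x; apply: ii; rewrite hs ex.
have ej : j = fun x => i (s x) by apply/funext => x; rewrite hs.
case: _ / (esym ej) in jj hs ij ji *.
rewrite /part (sinj_comp U ii si jj) scompA.
rewrite [up _ (scomp _ (sinj U si)) _]up_comp; last exact: (onto_sinj U si so).
by rewrite [RHS](low_comp (fun y => f (i y)) _ so) low_up_inj.
Qed.

Lemma part_comp d X Y (f : 'I_X -> 'I_d) (phi : smor P X k)
    (i : 'I_Y -> 'I_X) (ii : injective i) e (j : 'I_e -> 'I_Y)
    (jj : injective j) (ij : injective (fun x => i (j x))) :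
  part (fun y => f (i y)) (scomp phi (sinj U ii)) jj = part f phi ij.
Proof. by rewrite /part -scompA -sinj_comp. Qed.

(** Subsets of Y correspond to the subsets of X that lie in the image of i. *)
Lemma sum_parts_inj d X (f : 'I_X -> 'I_d) (phi : smor P X k) Y
    (i : 'I_Y -> 'I_X) (ii : injective i) (C : pred {set 'I_X}) :
  \sum_(S : {set 'I_Y} | C (i @: S))
     part f phi (inj_comp ii (@enum_val_inj _ (pred_of_set S))) =
  \sum_(S : {set 'I_X} | C S && (S \subset [set i y | y in 'I_Y]))
     set_part f phi S.
Proof.
rewrite [RHS](reindex_onto (fun S : {set 'I_Y} => i @: S) (fun S => i @^-1: S)) /=.
  apply: eq_big => [S|S _].
    rewrite (_ : i @: S \subset _) ?andbT; last exact: imsetS (subset_predT _).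
    rewrite (_ : i @^-1: (i @: S) == S) ?andbT //; apply/eqP/setP => y.
    by rewrite inE mem_imset.
  apply: part_image => x.
    have /imsetP[y yS ->] : set_val (i @: S) x \in i @: S by apply: enum_valP.
    by have [z <-] := set_val_rank yS; exists z.
  by apply: set_val_rank; apply: imset_f; apply: enum_valP.
move=> S /andP[_ /subsetP Si]; apply/setP => x; apply/imsetP/idP => [[y]|xS].
  by rewrite inE => yS ->.
by have /imsetP[y _ ey] := Si x xS; exists y; rewrite // inE -ey.
Qed.

Lemma span_sum_bij d X X' (f : 'I_X -> 'I_d) (phi : smor P X k)
    (s : 'I_X' -> 'I_X) (si : injective s) : onto s ->
  span_sum (fun x => f (s x)) (scomp phi (sinj U si)) = span_sum f phi.
Proof.
move=> so; rewrite /span_sum.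
under eq_bigr => S _ do
  rewrite (part_comp f phi si _ (inj_comp si (@enum_val_inj _ (pred_of_set S)))).
rewrite (sum_parts_inj f phi si xpredT); apply: eq_bigl => S /=.
by apply/subsetP => x _; have [y <-] := so x; apply: imset_f.
Qed.

Lemma span_sum_welldef d X X' (f : 'I_X -> 'I_d) (phi : smor P X k)
    (f' : 'I_X' -> 'I_d) (phi' : smor P X' k) :
  comp (cov P f) (con phi) = comp (cov P f') (con phi') ->
  span_sum f phi = span_sum f' phi'.
Proof.
move=> /(span_uniq U)[s [si [so ef ->]]].
by rewrite -(span_sum_bij f phi si so); congr span_sum; apply/funext => x; rewrite ef.
Qed.

Lemma extension_exists d (a : @hom FC k d) : exists v : M d,
  forall X (f : 'I_X -> 'I_d) (phi : smor P X k),
    a = comp (cov P f) (con phi) -> v = span_sum f phi.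
Proof.
have [X [phi [f ->]]] := free_span a.
by exists (span_sum f phi) => X' f' phi' /span_sum_welldef.
Qed.

(** The coherent family generated by m: it is defined on spans, and depends only on
    the morphism that they represent by [span_sum_welldef]. *)
Definition extension : family M k :=
  fun d (a : @hom FC k d) => projT1 (cid (extension_exists a)).

Lemma extensionE d X (f : 'I_X -> 'I_d) (phi : smor P X k) :
  extension (comp (cov P f) (con phi)) = span_sum f phi.
Proof. exact: (projT2 (cid (extension_exists _))). Qed.

Lemma onto_imset n e (T : {set 'I_n}) (r : 'I_e -> 'I_#|T|)
    (g : 'I_e -> 'I_n) : (forall x, set_val T (r x) = g x) ->
  onto r <-> [set g x | x in 'I_e] = T.
Proof.
move=> hr; split=> [ro|eT y].
  apply/setP => y; apply/imsetP/idP => [[x _ ->]|yT].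
    by rewrite -hr enum_valP.
  have [z <-] := set_val_rank yT; have [x <-] := ro z.
  by exists x; rewrite ?hr.
have /imsetP[x _ ex] : set_val T y \in [set g x | x in 'I_e].
  by rewrite eT; apply: enum_valP.
by exists x; apply: enum_val_inj; rewrite hr ex.
Qed.

(** The pullback of f along the inclusion of T, with the preimage of T as apex;
    in this case the decorations of the pullback are trivial as well. *)
Lemma con_sinj_pull d X (f : 'I_X -> 'I_d) (T : {set 'I_d})
    (S := f @^-1: T) (r : 'I_#|S| -> 'I_#|T|) :
  (forall x, set_val T (r x) = f (set_val S x)) ->
  comp (con (set_sinj U T)) (cov P f) = comp (cov P r) (con (set_sinj U S)).
Proof.
move=> hr; apply: gen_ext => x; rewrite !gen_fsub_comp !gen_fsub fext_eta.
have [xS|xS] := boolP (x \in S).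
  by have [y <-] := set_val_rank xS; rewrite -hr !semb_sinj fext_eta.
rewrite !semb_sinj_nil ?alg_hom_pt // => y e; case/negP: xS.
  by rewrite -e enum_valP.
by rewrite inE -e enum_valP.
Qed.

Lemma imset_comp_val n e l (S : {set 'I_n}) (i : 'I_n -> 'I_e) (g : 'I_e -> 'I_l) :
  [set g (i (set_val S x)) | x in 'I_#|S|] = g @: (i @: S).
Proof.
apply/setP => z; apply/imsetP/imsetP => [[x _ ->]|[y /imsetP[x xS ->] ->]].
  by exists (i (set_val S x)) => //; apply: imset_f; apply: enum_valP.
by have [w <-] := set_val_rank xS; exists w.
Qed.

(** The subsets S of the apex X of a are sorted by their image T = f(S); those
    with image T are the subsets of the apex of the restriction of a to T, which
    map onto T. *)
Lemma extension_low : low_coherent extension.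
Proof.
move=> d d' g a; have [X [phi [f ->]]] := free_span a.
rewrite compA -cov_comp extensionE /span_sum.
rewrite (partition_big (fun S : {set 'I_X} => f @: S) xpredT) //=.
apply: eq_bigr => T _; set S := f @^-1: T.
have [x|r hr] := @choice 'I_#|S| _ (fun x y => set_val T y = f (set_val S x)).
  by apply: set_val_rank; have := enum_valP x; rewrite inE.
(* Both sides are now sums over subsets with image T; on the right, they are
   subsets A of the preimage S of T, and those that r does not map onto T
   contribute zero. *)
rewrite -[alg_comp _ _]/(comp (con (set_sinj U T)) (comp (cov P f) (con phi))).
rewrite compA (con_sinj_pull hr) -compA -con_comp extensionE /span_sum raddf_sum.
rewrite (bigID (fun A : {set 'I_#|S|} => f @: (set_val S @: A) == T)) /=.
rewrite [X in _ = _ + X]big1 ?addr0 => [|A nA]; last first.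
  rewrite /part [low _ _ _]low_miss ?raddf0 // => ro.
  case/negP: nA; rewrite -imset_comp_val; apply/eqP.
  by apply/(onto_imset (r := fun x => r (set_val A x))) => // x; rewrite hr.
transitivity (\sum_(A : {set 'I_#|S|} | f @: (set_val S @: A) == T)
   part (fun x => g (f x)) phi
     (inj_comp (@enum_val_inj _ (pred_of_set S)) (@enum_val_inj _ (pred_of_set A)))).
  rewrite (sum_parts_inj _ _ _ (fun A => f @: A == T)); apply: eq_bigl => A.
  case: eqP => // AT /=; apply/esym/subsetP => x xA.
  have xS : x \in S by rewrite inE -AT imset_f.
  by have [y <-] := set_val_rank xS; apply: imset_f.
apply: eq_bigr => A /eqP AT.
have ro : onto (fun x => r (set_val A x)).
  apply/(onto_imset (g := fun x => f (set_val S (set_val A x)))) => [x|].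
    by rewrite hr.
  by rewrite imset_comp_val.
rewrite /part -scompA -(sinj_comp U _ _ (inj_comp
  (@enum_val_inj _ (pred_of_set S)) (@enum_val_inj _ (pred_of_set A)))).
rewrite -(low_comp (fun x => g (set_val T x))) //.
by apply: low_ext => x; rewrite /= hr.
Qed.

Lemma gen_comp_cov n l e (a : @hom FC l e) (f : 'I_n -> 'I_l) c :
  gen (comp a (cov P f)) c = gen a (f c).
Proof. by rewrite gen_comp gen_fsub. Qed.

(** [cov i] after [con (sinj i)] deletes the letters outside the image of i;
    the words of phi on j have none of them. *)
Lemma cov_con_sinj_id n l e (phi : smor P e l) (i : 'I_n -> 'I_e)
    (ii : injective i) (j : 'I_l) : (forall x, phi x = j -> exists y, i y = x) ->
  gen (comp (comp (cov P i) (con (sinj U ii))) (con phi)) j = semb phi j.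
Proof.
move=> h; rewrite gen_comp gen_fsub /semb.
rewrite [X in afun _ X]cls_mu afun_mu [RHS]cls_mu; congr mu; apply/funext => t.
have [y <-] := h _ (fib_valP t).
by rewrite -[LHS]/(gen _ _) gen_fsub_comp gen_fsub semb_sinj fext_eta.
Qed.

(** The span of con(rho) . a has the pullback Q of f and rho as apex.  A subset
    of Q contributes according to its image T in X: the subsets with image T
    live in the pullback of f|T and rho, and their sum is M^*(rho) M_*(f|T) by
    the pseudo-Mackey formula. *)
Lemma extension_up : up_coherent extension.
Proof.
move=> d d' [rho hrho] a /=; have [X [phi [f ->]]] := free_span a.
have ro : onto rho by apply/surjP.
have [Q [h [th [pb e]]]] := free_pullback f rho.
rewrite -[alg_comp _ _]/(comp (con rho) (comp (cov P f) (con phi))).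
rewrite compA e -compA -con_comp !extensionE -up_hom /= /span_sum raddf_sum.
rewrite (partition_big (fun A : {set 'I_Q} => th @: A) xpredT) //=.
apply: eq_bigr => T _; set S := th @^-1: T.
(* If f is not onto on T, both sides vanish: on the left, h maps onto d' only if
   f maps the image T onto d, as f th = rho h and rho is onto. *)
have [fo|nf] := pselect (onto (fun x => f (set_val T x))); last first.
  rewrite [set_part f phi T]low_miss // raddf0 big1 // => A /eqP AT.
  apply: low_miss => ho; apply: nf => y; have [z <-] := ro y.
  have [x <-] := ho z; rewrite pb.1.
  have xT : th (set_val A x) \in T by rewrite -AT; apply: imset_f; apply: enum_valP.
  by have [w <-] := set_val_rank xT; exists w.
have [x|r hr] := @choice 'I_#|S| _ (fun x y => set_val T y = th (set_val S x)).
  by apply: set_val_rank; have := enum_valP x; rewrite inE.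
pose Si := @enum_val_inj _ (pred_of_set S).
have [x|t [tr tS]] :=
  @smor_factor P U _ _ _ (scomp th (set_sinj U S)) _ (@enum_val_inj _ (pred_of_set T)) r.
  by rewrite hr /= !ffunE.
(* The preimage S of T in Q, with the restrictions of h and th, is the pullback
   of f restricted to T along rho. *)
have pbT : is_pullback (fun x => h (set_val S x)) (fun x => f (set_val T x)) t rho.
  split=> [x|b c ebc]; first by rewrite pb.1 tr hr.
  have [q [[e1 e2] u]] := pb.2 b (set_val T c) ebc.
  have qS : q \in S by rewrite inE e2 enum_valP.
  have [x ex] := set_val_rank qS; exists x; split.
    by rewrite ex; split=> //; apply: enum_val_inj; rewrite tr hr ex.
  move=> x' [e1' e2']; apply: Si; rewrite ex; apply: u; split=> //.
  by rewrite -hr -tr e2'.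
have sq : comp (con rho) (cov P (fun x => f (set_val T x))) =
    comp (cov P (fun x => h (set_val S x))) (con t).
  have et : con t = comp (comp (con (set_sinj U S)) (con th)) (cov P (set_val T)).
    by rewrite -con_comp -tS con_comp -compA con_sinj_cov compc1.
  rewrite (cov_comp P f) (cov_comp P h) compA e et -!compA; congr (comp _ _).
  apply: gen_ext => c; rewrite !compA !gen_comp_cov gen_fsub.
  rewrite cov_con_sinj_id // => x ex.
  by apply: set_val_rank; rewrite inE ex enum_valP.
rewrite [set_part f phi T]/part (up_low_square MM _ pbT sq fo ro).
rewrite (bigID (fun A : {set 'I_#|S|} => th @: (set_val S @: A) == T)) /=.
rewrite [X in _ = _ + X]big1 ?addr0 => [|A nA]; last first.
  rewrite [up _ _ _]up_miss ?raddf0 // => to.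
  case/negP: nA; rewrite -imset_comp_val; apply/eqP.
  apply/(onto_imset (r := fun x => r (set_val A x))) => [x|]; first by rewrite hr.
  by apply: onto_ext to => x; rewrite /= !ffunE tr.
transitivity (\sum_(A : {set 'I_#|S|} | th @: (set_val S @: A) == T)
   part h (scomp phi th) (inj_comp Si (@enum_val_inj _ (pred_of_set A)))).
  rewrite (sum_parts_inj _ _ _ (fun A => th @: A == T)); apply: eq_bigl => A.
  case: eqP => // AT /=; apply/esym/subsetP => x xA.
  have xS : x \in S by rewrite inE -AT imset_f.
  by have [y <-] := set_val_rank xS; apply: imset_f.
apply: eq_bigr => A /eqP AT.
have to : onto (scomp t (set_sinj U A)).
  have: onto (fun x => r (set_val A x)).
    apply/(onto_imset (g := fun x => th (set_val S (set_val A x)))) => [x|].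
      by rewrite hr.
    by rewrite imset_comp_val.
  by apply: onto_ext => x; rewrite /= !ffunE tr.
rewrite -(up_comp _ _ to) /part; congr (low M _ (up M _ m)).
rewrite (sinj_comp U Si (@enum_val_inj _ (pred_of_set A))).
rewrite -(scompA phi th) (scompA th (sinj U Si)) -tS.
by rewrite -(scompA (set_sinj U T) t) (scompA phi (set_sinj U T)).
Qed.

Definition extension_coh : coh M k :=
  exist _ extension (conj extension_up extension_low).

Lemma extension_con X (phi : smor P X k) : ~ onto phi -> extension (con phi) = 0.
Proof.
move=> np; rewrite -[con phi]comp1c -cov_id extensionE /span_sum big1 // => S _.
rewrite /part up_miss ?raddf0 // => h; apply: np => y.
by have [x <-] := h y; rewrite /= !ffunE; exists (set_val S x).
Qed.

(** By separation it suffices to look at the retractions onto subsets S after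
    the generator i is killed.  For i in S the letter i is absent from the
    values; for i outside S killing i changes nothing, and the decorated leg is
    not onto. *)
Lemma extension_pure : pure U (extension_coh : coh_functor M k).
Proof.
move=> i; apply: coh_separates => S.
rewrite -[LHS]/(sval extension_coh _ (comp (con (set_sinj U S)) (kill U i))).
have [iS|iS] := boolP (i \in S).
  have [t et] := set_val_rank iS; apply: (@coh_miss _ _ _ _ _ _ _ t).
  have := kill_con U (set_sinj U S) t.
  by rewrite [sfun _ t]ffunE et.
rewrite con_kill_miss => [|x].
  by apply: extension_con => h; case: (h i) => x; rewrite /= ffunE => e;
     case/negP: iS; rewrite -e enum_valP.
by rewrite /= ffunE => e; case/negP: iS; rewrite -e enum_valP.
Qed.

(** Among the subsets of the apex of the identity span, only the full one maps
    onto k. *)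
Lemma extension_id : extension (idc (k : FC)) = m.
Proof.
have -> : idc (k : FC) = comp (cov P (fun x : 'I_k => x)) (con (sid U k)).
  by rewrite cov_id comp1c con_id.
rewrite extensionE /span_sum (bigD1 setT) //= big1 ?addr0 => [|S ST].
  rewrite /part scomp1c low_up_inj //; exact: onto_setT.
apply: low_miss => h; case/eqP: ST; apply/setP => x; rewrite inE.
by have [y <-] := h x; rewrite enum_valP.
Qed.
End SpanExtension.

Lemma counit_bijective (P : operad) (U : unitary P) (M : janus U)
  (MM : pseudo_mackey M) k : bijective (counit_map M k).
Proof.
apply: additive_bij => [|m]; first exact: counit_inj.
by exists (exist _ (extension_coh MM m) (extension_pure MM m)); apply: extension_id.
Qed.

(** * The equivalence *)

Lemma isomorphic_functors_sym (C D : category) (F G : functor C D) :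
  isomorphic_functors F G -> isomorphic_functors G F.
Proof. by case=> s [t [ts st]]; exists t, s. Qed.

Lemma unit_natural_functor (P : operad) (U : unitary P)
    (F G : functor (free_category P) Ab) (s : nat_trans F G) :
  nt_comp (unit_nt U G) s = nt_comp (coh_nat (cr_janus_hom U s)) (unit_nt U F).
Proof.
apply: nat_trans_ext => k; apply: additive_ext => x; apply: coh_ext => d a.
apply: subgroup_ext.
transitivity (proj U (fmap G a (s k x))); first by [].
transitivity (s d (proj U (fmap F a x))); last by [].
by rewrite nt_proj nt_fmap.
Qed.

Lemma counit_natural (P : operad) (U : unitary P) (M N : janus U)
    (MM : pseudo_mackey M) (MN : pseudo_mackey N) (s : janus_hom M N) :
  janus_comp (counit_hom MN) (cr_janus_hom U (coh_nat s)) =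
  janus_comp s (counit_hom MM).
Proof. by apply: janus_hom_ext => k; apply: additive_ext. Qed.

Theorem corollary4p9 (P : operad) (U : unitary P) (n : nat) :
  equivalent_categories (reduced_polynomial_functors U n)
    (pseudo_mackey_functors_le U n).
Proof.
set Poly := reduced_polynomial_functors U n.
set Mack := pseudo_mackey_functors_le U n.
pose C := cr_functor U n; pose R := coherent_functor U n.
exists C, R; split.
  apply: isomorphic_functors_sym.
  pose s : nat_trans (id_functor Poly) (functor_comp R C) :=
    @NatTrans Poly Poly (id_functor Poly) (functor_comp R C)
      (fun F => unit_nt U (sval F))
      (fun F G t => unit_natural_functor U t).
  have [F|t st] := @nat_iso _ _ _ _ s; last by exists s, t.
  exact: (@nat_iso_ab _ _ _ (unit_nt U (sval F)) (unit_bijective U (sval F))).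
pose s : nat_trans (functor_comp C R) (id_functor Mack) :=
  @NatTrans Mack Mack (functor_comp C R) (id_functor Mack)
    (fun M => counit_hom (svalP M).1)
    (fun M N t => counit_natural (svalP M).1 (svalP N).1 t).
have [M|t st] := @nat_iso _ _ _ _ s; last by exists s, t.
exact: (@janus_iso _ _ _ _ (counit_hom (svalP M).1) (counit_bijective (svalP M).1)).
Qed.
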